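(* Let $\alpha\in(0,1)$, let $D>0$, and let $(B,\|\cdot\|)$ be a $(2,D)$-smooth separable Banach space. Let $(X_i,\mathcal{F}_i)_{i\ge 1}$ be a sequence of $B$-valued martingale differences satisfying $$\sup_{i\ge 1}\ \sup_{t>0}\ \exp\left\{t^{\frac{2\alpha}{1-\alpha}}\right\}\,\mathbb{P}\left(\|X_i\|>t\right)\le C_1$$ for some constant $C_1$. Put $S_k=\sum_{i=1}^k X_i$. Then, for all $x>0$ and all $n\ge 1$, $$\mathbb{P}\left(\max_{1\le k\le n}\|S_k\|>nx\right)\le C(\alpha,x)\,\exp\left\{-\left(\frac{x}{4D}\right)^{2\alpha}n^{\alpha}\right\},$$ where $$C(\alpha,x)=2+1007156\,e^2D^2C_1\left(\frac{1}{x^{2\alpha}\,16^{1-\alpha}\,D^{2(1-\alpha)}}+\frac{1}{x^2}\left(\frac{3(1-\alpha)}{2\alpha}\right)^{\frac{1-\alpha}{\alpha}}\right)$$ does not depend on $n$. In particular (with $x=1$), $$\mathbb{P}\left(\max_{1\le k\le n}\|S_k\|>n\right)=O\left(\exp\left\{-\frac{1}{(4D)^{2\alpha}}\,n^{\alpha}\right\}\right),\qquad n\to\infty.$$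
   Context: Let $(\Omega,\mathcal{F},\mathbb{P})$ be a probability space and $(B,\|\cdot\|)$ a separable Banach space. For $p\ge1$, $\mathbb{L}^p_B$ denotes the space of $B$-valued random variables $X$ with $\mathbb{E}[\|X\|^p]<\infty$. Martingale differences: let $(\mathcal{F}_i)_{i\ge1}$ be a non-decreasing sequence of sub-$\sigma$-algebras of $\mathcal{F}$. A sequence $(X_i)_{i\ge1}$ of $B$-valued random variables is a martingale difference sequence with respect to $(\mathcal{F}_i)_{i\ge1}$ (written $(X_i,\mathcal{F}_i)_{i\ge1}$) if (1) for every $i\ge1$, $X_i$ is $\mathcal{F}_i$-measurable and belongs to $\mathbb{L}^1_B$; (2) for every $i\ge2$, $\mathbb{E}[X_i\mid\mathcal{F}_{i-1}]=0$ almost surely. Smoothness: for $1<r\le2$, a Banach space $(B,\|\cdot\|)$ is $r$-smooth if there is an equivalent norm $\|\cdot\|'$ such that $$\sup_{t>0}\frac{1}{t^r}\sup\left\{\|x+ty\|'+\|x-ty\|'-2:\ \|x\|'=\|y\|'=1\right\}<\infty.$$ For $1<r\le 2$ and $D>0$, $B$ is $(r,D)$-smooth if $B$ is $r$-smooth and, for all $B$-valued martingale difference sequences $(X_i)_{i\ge1}$ and all $n\ge1$, $$\mathbb{E}\left\|\sum_{i=1}^nX_i\right\|^r\le D\sum_{i=1}^n\mathbb{E}\|X_i\|^r.$$ *)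

(* Defs.v *)
From HB Require Import structures.
From mathcomp Require Import all_boot all_order all_algebra.
From mathcomp Require Import all_classical all_reals all_analysis.

Set Implicit Arguments.
Unset Strict Implicit.
Unset Printing Implicit Defensive.

Import Order.TTheory GRing.Theory Num.Theory.
Import numFieldNormedType.Exports.

Local Open Scope classical_set_scope.
Local Open Scope ring_scope.

Definition separable (T : topologicalType) : Prop :=
  exists A : set T, countable A /\ dense A.

(* [G] is a collection of subsets of [T]; it is meant to be a sigma-algebra,
   so that all Borel preimages are required to lie in [G] itself. *)
Definition borel_measurable_wrt (R : realType) (T : Type)
    (B : completeNormedModType R) (G : set (set T)) (X : T -> B) : Prop :=
  forall U : set B, <<s @open B >> U -> G (X @^-1` U).

Definition Lp_space (d : measure_display) (T : measurableType d)
    (R : realType) (P : probability T R) (B : completeNormedModType R)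
    (p : R) (X : T -> B) : Prop :=
  borel_measurable_wrt (@measurable d T) X /\
  ('E_P[fun w => (`|X w| `^ p)%R] < +oo)%E.

Definition simple_integral (d : measure_display) (T : measurableType d)
    (R : realType) (P : probability T R) (B : completeNormedModType R)
    (A : set T) (s : {fimfun T >-> B}) : B :=
  \sum_(y \in range s) fine (P (A `&` s @^-1` [set y])) *: y.

(* [X] is Bochner integrable over [A], with integral [v]. *)
Definition is_bochner_integral (d : measure_display) (T : measurableType d)
    (R : realType) (P : probability T R) (B : completeNormedModType R)
    (A : set T) (X : T -> B) (v : B) : Prop :=
  exists s : nat -> {fimfun T >-> B},
    [/\ forall n, borel_measurable_wrt (@measurable d T) (s n),
        (\int[P]_(w in A) (`|s n w - X w|%R)%:E)%E @[n --> \oo] --> 0%E &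
        simple_integral P A (s n) @[n --> \oo] --> v].

(* [Y] is a version of the conditional expectation of [X] given the
   sub-sigma-algebra [G]. *)
Definition is_cond_expectation (d : measure_display) (T : measurableType d)
    (R : realType) (P : probability T R) (B : completeNormedModType R)
    (G : set (set T)) (X Y : T -> B) : Prop :=
  [/\ borel_measurable_wrt G Y,
      Lp_space P 1 Y &
      forall A : set T, G A ->
        exists v : B, is_bochner_integral P A X v /\
                      is_bochner_integral P A Y v].

(* Sequences are indexed from 1; the term of index 0 is irrelevant. *)
Definition is_filtration (d : measure_display) (T : measurableType d)
    (F : nat -> set (set T)) : Prop :=
  [/\ forall i, (1 <= i)%N -> sigma_algebra [set: T] (F i),
      forall i, (1 <= i)%N -> F i `<=` @measurable d T &
      forall i j, (1 <= i)%N -> (i <= j)%N -> F i `<=` F j].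

Definition martingale_difference (d : measure_display) (T : measurableType d)
    (R : realType) (P : probability T R) (B : completeNormedModType R)
    (X : nat -> T -> B) (F : nat -> set (set T)) : Prop :=
  [/\ is_filtration F,
      forall i, (1 <= i)%N ->
        borel_measurable_wrt (F i) (X i) /\ Lp_space P 1 (X i) &
      forall i, (2 <= i)%N ->
        exists Y : T -> B, is_cond_expectation P (F i.-1) (X i) Y /\
                           {ae P, forall w, Y w = 0}].

Definition is_equivalent_norm (R : realType) (B : completeNormedModType R)
    (N : B -> R) : Prop :=
  [/\ forall x y, N (x + y) <= N x + N y,
      forall (a : R) x, N (a *: x) = `|a| * N x,
      forall x, N x = 0 -> x = 0 &
      exists a b : R, [/\ 0 < a, 0 < b &
        forall x, a * `|x| <= N x /\ N x <= b * `|x|]].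

Definition smoothness_values (R : realType) (B : completeNormedModType R)
    (N : B -> R) (t : R) : set R :=
  [set z | exists x y : B,
     [/\ N x = 1, N y = 1 & z = N (x + t *: y) + N (x - t *: y) - 2]].

Definition r_smooth (R : realType) (B : completeNormedModType R) (r : R) :
    Prop :=
  exists N : B -> R, is_equivalent_norm N /\
    (ereal_sup [set (1 / t `^ r)%R%:E *
                    ereal_sup (EFin @` smoothness_values N t)
               | t in [set t : R | (0 < t)%R]] < +oo)%E.

(* Smoothness is a property of the Banach space alone: the martingale
   differences live on arbitrary probability spaces and filtrations. *)
Definition rD_smooth (R : realType) (B : completeNormedModType R) (r D : R) :
    Prop :=
  r_smooth B r /\
  forall (d : measure_display) (T : measurableType d) (P : probability T R)
    (X : nat -> T -> B) (F : nat -> set (set T)),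
    martingale_difference P X F ->
    forall n, (1 <= n)%N ->
      ('E_P[fun w => (`|\sum_(1 <= i < n.+1) X i w| `^ r)%R] <=
       D%:E * \sum_(1 <= i < n.+1) 'E_P[fun w => (`|X i w| `^ r)%R])%E.

Definition partial_sum (T : Type) (V : zmodType) (X : nat -> T -> V)
    (k : nat) (w : T) : V :=
  \sum_(1 <= i < k.+1) X i w.

(* The norms are nonnegative, so the default value 0 of the iterated maximum
   does not change the maximum over 1 <= k <= n when n >= 1. *)
Definition max_norm_sum (T : Type) (R : realType)
    (B : completeNormedModType R) (X : nat -> T -> B) (n : nat) (w : T) : R :=
  \big[Num.max/0]_(1 <= k < n.+1) `|partial_sum X k w|.

(* 1007 * 10 ^+ 3 + 156 is the constant 1007156; a literal of this size would
   be a unary natural number. *)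
Definition C_const (R : realType) (D C1 alpha x : R) : R :=
  2 + (1007 * 10 ^+ 3 + 156) * expR 1 ^+ 2 * D ^+ 2 * C1 *
    ((x `^ (2 * alpha) * 16 `^ (1 - alpha) * D `^ (2 * (1 - alpha)))^-1 +
     (x ^+ 2)^-1 *
       ((3 * (1 - alpha)) / (2 * alpha)) `^ ((1 - alpha) / alpha)).

(* Main.v *)
(* The moment inequality is first turned into a pointwise one.  Let phi x be
   the supremum, over the Walsh-Paley martingales started at x, of
   E |M_n|^2 - D * (sum of the E |increment|^2).  Testing (2,D)-smoothness on
   coin tossing gives |x|^2 <= phi x <= D |x|^2, and prepending one toss gives
   phi (x + y) + phi (x - y) <= 2 phi x + 2 D |y|^2.  Hence phi has one-sided
   directional derivatives psi x y with
   phi (x + y) <= phi x + psi x y + D |y|^2; they are superadditive and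
   positively homogeneous in y, so a centered step contributes at most 0 on
   average, and |psi x y| <= 2 sqrt (D phi x) |y|.  Convexity of cosh (sqrt t)
   then makes exp (- n l^2 D b^2 / 2) cosh (l sqrt (phi M_n)) a supermartingale
   when the increments are bounded by b: this is Pinelis' inequality
   P (max |M_k| > r) <= 2 exp (- r^2 / (2 n D b^2)).

   The martingale is compared with one on a finite probability space, where
   conditional expectations are weighted averages: each X_i is replaced by a
   nearby value taken from a dense sequence, split at the level
   u = (x / 4D)^(1 - alpha) n^((1 - alpha) / 2), and both parts are recentered.
   As E [X_i | F_(i-1)] = 0, recentering costs no more than the L^1 distance to
   X_i, which is arbitrarily small.  The bounded part is controlled by Pinelis'
   inequality, the tail part by its second moment, both with stopping in place
   of a maximal inequality. *)
Require Import Defs.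
From HB Require Import structures.
From mathcomp Require Import all_boot all_order all_algebra.
From mathcomp Require Import all_classical all_reals all_analysis.
From mathcomp Require Import finmap measurable_realfun.
From mathcomp Require Import ring lra.

Set Implicit Arguments.
Unset Strict Implicit.
Unset Printing Implicit Defensive.

Import Order.TTheory GRing.Theory Num.Theory.
Import numFieldNormedType.Exports.

Local Open Scope classical_set_scope.
Local Open Scope ring_scope.

(** * Hyperbolic cosine *)

Definition coshR (R : realType) (x : R) : R := (expR x + expR (- x)) / 2.

(** Partial sums of the power series of cosh (sqrt s) in the variable s. All coefficients are
    nonnegative, which gives monotonicity and convexity for s >= 0. *)
Definition cosh_sqrt_sum (R : realType) (n : nat) (s : R) : R :=
  \sum_(k < n) s ^+ k / (k.*2)`!%:R.

Lemma ler_cvgn (R : realType) (u v : nat -> R) (l m : R) :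
  u n @[n --> \oo] --> l -> v n @[n --> \oo] --> m ->
  (forall n, u n <= v n) -> l <= m.
Proof. by move=> ul vm uv; apply: (ler_cvg_to ul vm); apply: nearW. Qed.

Section Cosh.
Context {R : realType}.
Implicit Types a b c p s t x z : R.

Lemma cosh_sqrt_sumE x n : cosh_sqrt_sum n (x ^+ 2) =
  (series (exp_coeff x) n.*2 + series (exp_coeff (- x)) n.*2) / 2.
Proof.
rewrite !seriesEnat /=; elim: n => [|n IH].
  by rewrite /cosh_sqrt_sum big_ord0 !big_geq // addr0 mul0r.
rewrite /cosh_sqrt_sum big_ord_recr /= -/(cosh_sqrt_sum n (x ^+ 2)) IH doubleS.
rewrite !big_nat_recr //= !exp_coeffE /=.
have e : (- x) ^+ n.*2 = x ^+ n.*2.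
  by rewrite exprNn -signr_odd odd_double expr0 mul1r.
rewrite !(exprS _ n.*2) e -exprM mul2n.
set u := \sum_(_ <= _ < _) _; set v := \sum_(_ <= _ < _) _.
by field; rewrite !pnatr_eq0 -!lt0n !fact_gt0.
Qed.

Lemma cvg_cosh_sqrt_sum x :
  cosh_sqrt_sum n (x ^+ 2) @[n --> \oo] --> coshR x.
Proof.
have h y : series (exp_coeff y) n.*2 @[n --> \oo] --> expR y.
  apply: (cvg_comp (fun n => n.*2) (series (exp_coeff y))).
    apply/cvgnyPge => A; near=> n.
    have : (A <= n)%N by near: n; exists A.
    by move=> /leq_trans; apply; rewrite -addnn leq_addr.
  exact: is_cvg_series_exp_coeff.
under eq_cvg do rewrite cosh_sqrt_sumE.
apply: cvgMr_tmp; apply: cvgD; exact: h.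
Unshelve. all: by end_near.
Qed.

(** By induction: after the induction hypothesis the remaining gap is a (1 - a) (s - t) (s^n - t^n),
    whose last two factors have the same sign. *)
Lemma convex_exprn n s t a : 0 <= s -> 0 <= t -> 0 <= a -> a <= 1 ->
  (a * s + (1 - a) * t) ^+ n <= a * s ^+ n + (1 - a) * t ^+ n.
Proof.
move=> s0 t0 a0 a1; elim: n => [|n IH]; first by rewrite !expr0; lra.
have c0 : 0 <= a * s + (1 - a) * t by rewrite addr_ge0 ?mulr_ge0 ?subr_ge0.
rewrite exprS (le_trans (ler_wpM2l c0 IH)) // !exprS -subr_ge0.
rewrite (_ : _ - _ = a * (1 - a) * ((s - t) * (s ^+ n - t ^+ n))); last by ring.
apply: mulr_ge0; first by rewrite mulr_ge0 ?subr_ge0.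
case: (leP s t) => st.
  by apply: mulr_le0; rewrite subr_le0 // lerXn2r.
by apply: mulr_ge0; rewrite subr_ge0 ?lerXn2r ?nnegrE // ltW.
Qed.

Lemma ler_coshR x z : z ^+ 2 <= x ^+ 2 -> coshR z <= coshR x.
Proof.
move=> zx; apply: (ler_cvgn (@cvg_cosh_sqrt_sum z) (@cvg_cosh_sqrt_sum x)).
move=> n; apply: ler_sum => k _.
by rewrite ler_wpM2r ?invr_ge0 ?ler0n // lerXn2r ?nnegrE // sqr_ge0.
Qed.

(** Each truncated series is nondecreasing and convex in the square of its argument, and the
    inequality passes to the limit. *)
Lemma convex_coshR a x y z : 0 <= a -> a <= 1 ->
  z ^+ 2 <= a * x ^+ 2 + (1 - a) * y ^+ 2 ->
  coshR z <= a * coshR x + (1 - a) * coshR y.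
Proof.
move=> a0 a1 zxy.
have h : a * cosh_sqrt_sum n (x ^+ 2) + (1 - a) * cosh_sqrt_sum n (y ^+ 2)
    @[n --> \oo] --> a * coshR x + (1 - a) * coshR y.
  by apply: cvgD; apply: cvgMl_tmp; exact: cvg_cosh_sqrt_sum.
apply: (ler_cvgn (@cvg_cosh_sqrt_sum z) h).
move=> n; rewrite !mulr_sumr -big_split /=; apply: ler_sum => k _.
rewrite !mulrA -mulrDl ler_wpM2r ?invr_ge0 ?ler0n //.
apply: le_trans (convex_exprn k (sqr_ge0 x) (sqr_ge0 y) a0 a1).
by rewrite lerXn2r ?nnegrE ?sqr_ge0 // (le_trans _ zxy) // sqr_ge0.
Qed.

Lemma leq_expn_fact_double n : (2 ^ n * n`! <= (n.*2)`!)%N.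
Proof.
elim: n => // n IH; rewrite doubleS !factS expnS.
rewrite (_ : (2 * 2 ^ n * (n.+1 * n`!) = n.+1.*2 * (2 ^ n * n`!))%N); last first.
  by rewrite -muln2; ring.
rewrite leq_mul //; apply: (leq_trans IH); exact: leq_pmull.
Qed.

(** Compared term by term with the exponential series, through 2^n n! <= (2n)!. *)
Lemma coshR_le_expR x : coshR x <= expR (x ^+ 2 / 2).
Proof.
apply: (ler_cvgn (@cvg_cosh_sqrt_sum x) (is_cvg_series_exp_coeff (x ^+ 2 / 2))).
move=> n; rewrite /series /= big_mkord; apply: ler_sum => k _.
rewrite exp_coeffE /= expr_div_n [leRHS]mulrCA ler_wpM2l ?(exprn_ge0 _ (sqr_ge0 x)) //.
rewrite -invfM -natrX -natrM lef_pV2 ?posrE ?ltr0n ?muln_gt0 ?fact_gt0 ?expn_gt0 //.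
by rewrite ler_nat mulnC leq_expn_fact_double.
Qed.

Lemma coshRD a c : coshR (a + c) + coshR (a - c) = 2 * (coshR a * coshR c).
Proof. by rewrite /coshR !opprD opprK !expRD; field. Qed.

Lemma coshR0 : coshR (0 : R) = 1.
Proof. by rewrite /coshR oppr0 expR0; field. Qed.

Lemma coshR_ge1 x : 1 <= coshR x.
Proof. by rewrite -coshR0 ler_coshR // expr0n sqr_ge0. Qed.

Lemma expR_le_coshR x : expR x / 2 <= coshR x.
Proof. by rewrite ler_wpM2r // lerDl expR_ge0. Qed.

(* [cosh] of the norm of a sum is bounded by the chord, over the range
   [-2ac, 2ac] of the cross term [p], of the convex function [cosh \o sqrt]. *)
Lemma coshR_chord a c : 0 <= a -> 0 <= c -> exists2 k, 0 <= k &
  forall p z, `|p| <= 2 * (a * c) -> z ^+ 2 <= a ^+ 2 + p + c ^+ 2 ->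
    coshR z <= coshR a * coshR c + p * k.
Proof.
move=> a0 c0; have [ac0|ac0] := eqVneq (a * c) 0.
  exists 0 => // p z; rewrite ac0 mulr0 normr_le0 => /eqP ->.
  rewrite addr0 mulr0 addr0 => zac.
  have h : coshR z <= coshR (a + c).
    by apply: ler_coshR; rewrite sqrrD ac0 mul0rn addr0.
  apply: (le_trans h); move: ac0 => /eqP; rewrite mulf_eq0 => /orP[] /eqP ->.
    by rewrite add0r coshR0 mul1r.
  by rewrite addr0 coshR0 mulr1.
have acgt0 : 0 < a * c by rewrite lt_neqAle eq_sym ac0 mulr_ge0.
(* The slope of the chord between (a - c)^2 and (a + c)^2; by the addition formula its ordinate at
   the midpoint a^2 + c^2 is cosh a cosh c. *)
exists ((coshR (a + c) - coshR (a - c)) / (4 * (a * c))).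
  rewrite divr_ge0 ?mulr_ge0 // subr_ge0 ler_coshR // -subr_ge0.
  by rewrite (_ : _ - _ = 4 * (a * c)) ?mulr_ge0 //; ring.
move=> p z pac zac.
have pE : p = (p / (2 * (a * c))) * (2 * (a * c)) by field; apply/andP; split; move: ac0;
  rewrite mulf_eq0 negb_or => /andP[].
have : `|p / (2 * (a * c))| <= 1.
  have n0 : 0 < 2 * (a * c) by rewrite mulr_gt0.
  by rewrite normrM normfV (gtr0_norm n0) ler_pdivrMr // mul1r.
set q := p / _; rewrite -/q in pE; rewrite ler_norml => /andP[q1 q2].
have := @convex_coshR ((1 + q) / 2) (a + c) (a - c) z _ _ _.
move/(_ ltac:(lra) ltac:(lra)); apply: (fun H1 H2 H => le_trans (H H1) H2).
  by apply: (le_trans zac); rewrite le_eqVlt; apply/orP; left; apply/eqP; rewrite pE; field.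
have := coshRD a c; set X := coshR (a + c); set Y := coshR (a - c) => XY.
have -> : coshR a * coshR c = (X + Y) / 2 by rewrite XY; field.
rewrite pE (_ : q * _ * _ = q * ((X - Y) / 2)); first lra.
by field; apply/andP; split; move: ac0; rewrite mulf_eq0 negb_or => /andP[].
Qed.

End Cosh.

(** * Directional derivatives of a 2-smooth function *)

Section SmoothMajorant.
Context {R : realType} {B : normedModType R} (D : R) (phi : B -> R).
Hypothesis D_gt0 : 0 < D.
Hypothesis norm_le_phi : forall x, `|x| ^+ 2 <= phi x.
Hypothesis phi_smooth : forall x y,
  phi (x + y) + phi (x - y) <= 2 * phi x + 2 * D * `|y| ^+ 2.

(* The correction term makes the quotient monotone when [h] is halved. *)
Definition diffquot (h : R) (x y : B) : R :=
  (phi (x + h *: y) - phi x) / h - D * h * `|y| ^+ 2.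

(** Only the steps 2^-k are used, since the midpoint estimate compares h with h / 2. Homogeneity for
    real factors therefore has to be recovered separately. *)
Definition dirder (x y : B) : R := limn (fun k => diffquot (2^-1 ^+ k) x y).

Let half_gt0 k : 0 < 2^-1 ^+ k :> R.
Proof. by rewrite exprn_gt0. Qed.

Lemma phi_ge0 x : 0 <= phi x.
Proof. exact: le_trans (sqr_ge0 _) (norm_le_phi x). Qed.

Lemma phi_midpoint x y z :
  phi (x + y) + phi (x + z) <=
  2 * phi (x + 2^-1 *: (y + z)) + D / 2 * `|y - z| ^+ 2.
Proof.
have := phi_smooth (x + 2^-1 *: (y + z)) (2^-1 *: (y - z)).
have e : 2^-1 *: y + 2^-1 *: y = y by rewrite -scalerDl -[RHS]scale1r; congr (_ *: _); field.
have e' : 2^-1 *: z + 2^-1 *: z = z by rewrite -scalerDl -[RHS]scale1r; congr (_ *: _); field.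
rewrite -!addrA !scalerDr scalerN opprD opprK.
rewrite (addrACA (2^-1 *: y)) e subrr addr0 (addrACA (2^-1 *: y)) subrr add0r e'.
rewrite -scalerBr normrZ exprMn ger0_norm ?invr_ge0 //; move=> H.
by apply: (le_trans H); rewrite lerD2l le_eqVlt; apply/orP; left; apply/eqP; field.
Qed.

Lemma diffquot_half (h : R) x y : 0 < h -> diffquot h x y <= diffquot (h / 2) x y.
Proof.
move=> h0; have := phi_midpoint x (h *: y) 0.
rewrite !addr0 subr0 scalerA (mulrC 2^-1) normrZ exprMn (gtr0_norm h0) /diffquot.
set a := phi (x + _); set b := phi (x + _); set n : R := `|y| ^+ 2 => H.
rewrite -subr_ge0 (_ : _ - _ = (2 * b + D / 2 * (h ^+ 2 * n) - (a + phi x)) / h :> R).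
  by apply: divr_ge0; rewrite ?subr_ge0 // ltW.
by field; rewrite gt_eqF.
Qed.

(** Source of the upper bound in [cvg_dirder]: both quotients are nondecreasing along h = 2^-k, so
    each is bounded by the opposite of the other one at h = 1. *)
Lemma diffquotN (h : R) x y : 0 < h -> diffquot h x y + diffquot h x (- y) <= 0.
Proof.
move=> h0; have := phi_smooth x (h *: y).
rewrite /diffquot normrN scalerN normrZ exprMn (gtr0_norm h0).
set a := phi _; set b := phi (_ - _); set n : R := `|y| ^+ 2 => H.
have K : 0 <= (2 * phi x + 2 * D * (h ^+ 2 * n) - (a + b)) / h.
  by rewrite divr_ge0 ?(ltW h0) // subr_ge0.
rewrite -oppr_ge0; apply: (le_trans K); rewrite le_eqVlt; apply/orP; left; apply/eqP.
by field; rewrite gt_eqF.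
Qed.

Lemma diffquot_half_nondecreasing x y :
  nondecreasing_seq (fun k => diffquot (2^-1 ^+ k) x y).
Proof. by apply/nondecreasing_seqP => k; rewrite exprSr diffquot_half. Qed.

Lemma cvg_dirder x y : diffquot (2^-1 ^+ k) x y @[k --> \oo] --> dirder x y.
Proof.
apply: nondecreasing_is_cvgn; first exact: diffquot_half_nondecreasing.
exists (- diffquot 1 x (- y)) => _ [k _ <-].
have := diffquotN x y (half_gt0 k).
have := diffquot_half_nondecreasing x (- y) (leq0n k); rewrite expr0; lra.
Qed.

Lemma diffquot1_le_dirder x y : diffquot 1 x y <= dirder x y.
Proof.
apply: (ler_cvgn (cvg_cst (diffquot 1 x y)) (@cvg_dirder x y)) => k.
by have := diffquot_half_nondecreasing x y (leq0n k); rewrite expr0.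
Qed.

Lemma phi_le_dirder x y : phi (x + y) <= phi x + dirder x y + D * `|y| ^+ 2.
Proof.
have := diffquot1_le_dirder x y; rewrite /diffquot scale1r divr1 mulr1; lra.
Qed.

Lemma dirder_ge x y : - (phi x + D * `|y| ^+ 2) <= dirder x y.
Proof.
apply: le_trans (diffquot1_le_dirder x y); rewrite /diffquot divr1 mulr1.
have := phi_ge0 (x + 1 *: y); lra.
Qed.

Lemma cvg_half0 (c : R) : c * 2^-1 ^+ k @[k --> \oo] --> 0.
Proof.
rewrite -[X in _ --> X](mulr0 c); apply: cvgMl_tmp; apply: cvg_expr.
by rewrite gtr0_norm // invf_lt1 // ltr1n.
Qed.

(** The midpoint estimate at x + t y and x + t z lands on the step t / 2 in the direction y + z. The
    quadratic errors are of order t after division by t and vanish. *)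
Lemma dirderD x y z : dirder x y + dirder x z <= dirder x (y + z).
Proof.
have h : diffquot (2^-1 ^+ k.+1) x (y + z) +
    (D / 2 * (`|y + z| ^+ 2 + `|y - z| ^+ 2)) * 2^-1 ^+ k @[k --> \oo] -->
    dirder x (y + z) + 0.
  apply: cvgD; last exact: cvg_half0.
  have := @cvg_dirder x (y + z).
  by rewrite -(cvg_shiftS (fun k => diffquot (2^-1 ^+ k) x (y + z))).
rewrite -[leRHS]addr0.
apply: (ler_cvgn (cvgD (@cvg_dirder x y) (@cvg_dirder x z)) h) => k.
rewrite exprSr; have := half_gt0 k; set t := 2^-1 ^+ k => t0.
have := phi_midpoint x (t *: y) (t *: z).
rewrite -scalerDr -scalerBr scalerA (mulrC 2^-1) normrZ exprMn (gtr0_norm t0).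
rewrite /diffquot; set a := phi (_ + t *: y); set b := phi (_ + t *: z); set c := phi (_ + (_
  / 2) *: _) => H.
set n := `|y + z|; set m := `|y - z| in H *.
rewrite -subr_ge0 (_ : _ - _ = (2 * c + D / 2 * (t ^+ 2 * m ^+ 2) - (a + b)) / t + D * t *
  (`|y| ^+ 2 + `|z| ^+ 2) :> R).
  by rewrite addr_ge0 ?divr_ge0 ?(ltW t0) ?subr_ge0 // !mulr_ge0 ?(ltW t0) ?(ltW D_gt0) //
    addr_ge0 ?sqr_ge0.
by field; rewrite gt_eqF.
Qed.

Lemma dirder0 x : dirder x 0 = 0.
Proof.
apply/cvg_lim => //; apply: cvg_near_cst; apply: nearW => k.
by rewrite /diffquot scaler0 addr0 subrr mul0r normr0 expr0n mulr0 subr0.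
Qed.

Lemma dirder_half x y : dirder x (2^-1 *: y) = 2^-1 * dirder x y.
Proof.
apply/cvg_lim => //.
have : 2^-1 * diffquot (2^-1 ^+ k.+1) x y @[k --> \oo] --> 2^-1 * dirder x y.
  apply: cvgMl_tmp; have := @cvg_dirder x y.
  by rewrite -(cvg_shiftS (fun k => diffquot (2^-1 ^+ k) x y)).
apply: cvg_trans; apply: near_eq_cvg; apply: nearW => k.
rewrite /diffquot scalerA -exprSr normrZ exprMn ger0_norm ?invr_ge0 // exprS.
by field; rewrite expf_neq0.
Qed.

Lemma dirder_halfX k x y : dirder x (2^-1 ^+ k *: y) = 2^-1 ^+ k * dirder x y.
Proof.
elim: k => [|k IH]; first by rewrite !expr0 scale1r mul1r.
by rewrite exprS -scalerA dirder_half IH mulrA.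
Qed.

Lemma dirderMn n x y : n%:R * dirder x y <= dirder x (n%:R *: y).
Proof.
elim: n => [|n IH]; first by rewrite mul0r scale0r dirder0.
rewrite -natr1 mulrDl scalerDl mul1r scale1r (le_trans _ (dirderD _ _ _)) //.
by rewrite lerD2r.
Qed.

(** Write a = t (m + e) with t = 2^-k, m an integer and 0 <= e <= 1. The factors t and m are handled
    by halving and superadditivity; the remainder e costs a bounded amount times t, which tends to
    0. *)
Lemma dirderZ_ge (a : R) x y : 0 <= a -> a * dirder x y <= dirder x (a *: y).
Proof.
move=> a0; pose K := `|dirder x y| + (phi x + D * `|y| ^+ 2).
have h : a * dirder x y + - K * 2^-1 ^+ k @[k --> \oo] --> a * dirder x y + 0.
  by apply: cvgD; [exact: cvg_cst|exact: cvg_half0].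
rewrite -[leLHS]addr0.
apply: (ler_cvgn h (cvg_cst _)) => k.
have t0 := half_gt0 k; set t := 2^-1 ^+ k in t0 *.
pose m := Num.truncn (a / t).
have /andP[m1 m2] : m%:R <= a / t < m.+1%:R.
  by apply: truncn_itv; rewrite divr_ge0 // ltW.
pose e := a / t - m%:R.
have e0 : 0 <= e by rewrite subr_ge0.
have e1 : e <= 1 by rewrite lerBlDl natr1 ltW.
have aE : a = t * (m%:R + e) by rewrite /e; field; rewrite gt_eqF.
have -> : dirder x (a *: y) = t * dirder x (m%:R *: y + e *: y).
  by rewrite [in LHS]aE -scalerA dirder_halfX scalerDl.
have H1 := dirderD x (m%:R *: y) (e *: y).
have H2 := dirderMn m x y.
have H3 : - (phi x + D * `|y| ^+ 2) <= dirder x (e *: y).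
  apply: le_trans (dirder_ge _ _); rewrite lerN2 lerD2l ler_pM2l //.
  rewrite normrZ exprMn ger0_norm // ler_piMl ?sqr_ge0 //.
  by rewrite expr_le1.
have H4 : e * dirder x y <= `|dirder x y|.
  apply: (le_trans (ler_norm _)); rewrite normrM ler_piMl //.
  by rewrite ger0_norm.
rewrite [in leLHS]aE mulNr (mulrC K) -mulrA -mulrBr ler_pM2l // /K; lra.
Qed.

Lemma dirderZ (a : R) x y : 0 < a -> dirder x (a *: y) = a * dirder x y.
Proof.
move=> a0; apply/eqP; rewrite eq_le (dirderZ_ge _ _ (ltW a0)) andbT.
have := @dirderZ_ge a^-1 x (a *: y).
by rewrite scalerA mulVf ?gt_eqF // scale1r ler_pdivrMl //; apply; rewrite invr_ge0 ltW.
Qed.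

(** Since phi >= 0, the quadratic phi x + s psi + D s^2 |y|^2 is nonnegative for s > 0. When psi <
    0, its value at the minimizer gives the discriminant bound; when psi > 0, the derivative in the
    direction - y is at most - psi and the first case applies to it. *)
Lemma sqr_dirder_le x y : dirder x y ^+ 2 <= 4 * D * phi x * `|y| ^+ 2.
Proof.
have h z : dirder x z < 0 -> dirder x z ^+ 2 <= 4 * D * phi x * `|z| ^+ 2.
  move=> d0; have [->|z0] := eqVneq z 0.
    by rewrite dirder0 normr0 !expr0n mulr0.
  have n0 : 0 < `|z| ^+ 2 by rewrite exprn_gt0 // normr_gt0.
  set n : R := `|z| ^+ 2 in n0 *; set d := dirder x z in d0 *.
  have t0 : 0 < - d / (2 * D * n)
    by apply: divr_gt0; [rewrite oppr_gt0|apply: mulr_gt0 => //; apply: mulr_gt0].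
  have := le_trans (phi_ge0 _) (phi_le_dirder x ((- d / (2 * D * n)) *: z)).
  rewrite dirderZ // normrZ (gtr0_norm t0) exprMn -/d -/n => H.
  rewrite -subr_ge0 (_ : _ - _ = 4 * D * n * (phi x + - d / (2 * D * n) * d +
    D * ((- d / (2 * D * n)) ^+ 2 * n)) :> R).
    by rewrite mulr_ge0 // !mulr_ge0 // ltW.
  by field; rewrite !gt_eqF.
have hN := dirderD x y (- y); rewrite subrr dirder0 in hN.
case: (ltgtP (dirder x y) 0) => [/h //|d0|->]; last first.
  by rewrite expr0n !mulr_ge0 ?sqr_ge0 ?phi_ge0 // ltW.
have dN : dirder x (- y) < 0 by lra.
have := h _ dN; rewrite normrN; apply: le_trans.
rewrite -(sqrrN (dirder x (- y))) lerXn2r ?nnegrE //; lra.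
Qed.

Lemma sum_dirder (I : Type) (r : seq I) (Q : pred I) (y : I -> B) x :
  \sum_(i <- r | Q i) dirder x (y i) <= dirder x (\sum_(i <- r | Q i) y i).
Proof.
apply: (big_ind2 (fun a b => a <= dirder x b)) => [|a b c e ab ce|//].
  by rewrite dirder0.
by apply: le_trans (dirderD _ _ _); exact: lerD.
Qed.

(** Superadditivity points the right way: the weighted sum of derivatives is at most the derivative
    in the weighted sum of the directions. *)
Lemma sum_dirder_le0 (I : Type) (r : seq I) (Q : pred I) (p : I -> R)
    (y : I -> B) x : (forall i, 0 <= p i) ->
  \sum_(i <- r | Q i) p i *: y i = 0 ->
  \sum_(i <- r | Q i) p i * dirder x (y i) <= 0.
Proof.
move=> p0 y0; have := sum_dirder r Q (fun i => p i *: y i) x.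
rewrite y0 dirder0; apply: le_trans.
by apply: ler_sum => i _; exact: dirderZ_ge.
Qed.

End SmoothMajorant.

(** * Martingales on a finite probability space *)

Definition walk (K : Type) (V : zmodType) (d : nat -> K -> V) (n : nat)
  (k : K) : V := \sum_(i < n) d i k.

(* [h i k] is the history available just before the step [d i k]; as in
   [martingale_difference], the first step need not be centered. *)
Definition finite_martingale_difference (R : realType) (K H : finType)
    (B : lmodType R) (p : K -> R) (h : nat -> K -> H) (d : nat -> K -> B) :=
  [/\ forall i k k', h i.+1 k = h i.+1 k' -> h i k = h i k',
      forall i k k', h i.+1 k = h i.+1 k' -> d i k = d i k' &
      forall i v, (0 < i)%N -> \sum_(k | h i k == v) p k *: d i k = 0].

Section FiniteMartingale.
Context {R : realType} {B : normedModType R} (D : R) (phi : B -> R).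
Hypothesis D_gt0 : 0 < D.
Hypothesis norm_le_phi : forall x, `|x| ^+ 2 <= phi x.
Hypothesis phi_le_norm : forall x, phi x <= D * `|x| ^+ 2.
Hypothesis phi_smooth : forall x y,
  phi (x + y) + phi (x - y) <= 2 * phi x + 2 * D * `|y| ^+ 2.
Context {K H : finType} (p : K -> R).
Hypothesis p_ge0 : forall k, 0 <= p k.
Hypothesis p_sum1 : \sum_k p k = 1.

Local Notation psi := (dirder D phi).

Lemma walkS (d : nat -> K -> B) n k : walk d n.+1 k = walk d n k + d n k.
Proof. by rewrite /walk big_ord_recr. Qed.

Lemma walk_adapted (h : nat -> K -> H) (d : nat -> K -> B) :
  finite_martingale_difference p h d ->
  forall i k k', h i k = h i k' -> walk d i k = walk d i k'.
Proof.
case=> hm hd _; elim=> [|i IH] k k' e; first by rewrite /walk !big_ord0.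
by rewrite !walkS (IH _ k') ?(hd i k k') //; exact: hm.
Qed.

(** On a class of [h] both [w] and [x] are constant, so the weight factors out and the directions at
    a single base point average to 0. *)
Lemma sum_dirder_cond_le0 (h : K -> H) (w : K -> R) (x d : K -> B) :
  (forall k, 0 <= w k) ->
  (forall k k', h k = h k' -> w k = w k' /\ x k = x k') ->
  (forall v, \sum_(k | h k == v) p k *: d k = 0) ->
  \sum_k p k * (w k * psi (x k) (d k)) <= 0.
Proof.
move=> w0 hx d0; rewrite (partition_big h xpredT) //= sumr_le0 // => v _.
have [k0 /eqP hk0|hv] := pickP (fun k => h k == v); last by rewrite big_pred0.
rewrite (eq_bigr (fun k => w k0 * (p k * psi (x k0) (d k)))); last first.
  move=> k /eqP hk; have [|-> ->] := hx k k0; first by rewrite hk0.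
  by rewrite mulrCA.
rewrite -mulr_sumr mulr_ge0_le0 //.
exact: (sum_dirder_le0 D_gt0 norm_le_phi phi_smooth).
Qed.

(** Each step multiplies the expectation by at most cosh c, where c = l sqrt D b: the chord
    inequality leaves a cross term linear in psi, whose average is at most 0. Finally cosh c <= exp
    (c^2 / 2). *)
Lemma cosh_walk_bound (h : nat -> K -> H) (d : nat -> K -> B) (b l : R) n :
  finite_martingale_difference p h d -> 0 <= b -> 0 <= l ->
  (forall i k, `|d i k| <= b) ->
  \sum_k p k * coshR (l * Num.sqrt (phi (walk d n k))) <=
    expR (n%:R * (l ^+ 2 * (D * b ^+ 2) / 2)).
Proof.
move=> hd b0 l0 db; pose c := l * Num.sqrt D * b.
have c0 : 0 <= c by rewrite !mulr_ge0 // sqrtr_ge0.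
have cE : c ^+ 2 = l ^+ 2 * (D * b ^+ 2).
  by rewrite /c !exprMn sqr_sqrtr ?(ltW D_gt0) // mulrA.
have phi0 x : 0 <= phi x by apply: phi_ge0.
have phi00 : phi 0 = 0.
  by apply/eqP; rewrite eq_le phi0 andbT (le_trans (phi_le_norm 0)) // normr0 expr0n mulr0.
have dD i k : D * `|d i k| ^+ 2 <= D * b ^+ 2.
  by rewrite ler_pM2l // lerXn2r ?nnegrE.
suff [H0 H1] : \sum_k p k * coshR (l * Num.sqrt (phi (walk d 0 k))) <= coshR c ^+ 0 /\
    forall n, \sum_k p k * coshR (l * Num.sqrt (phi (walk d n.+1 k))) <= coshR c ^+ n.+1.
  have h1 : \sum_k p k * coshR (l * Num.sqrt (phi (walk d n k))) <= coshR c ^+ n.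
    by case: n => [|n].
  apply: (le_trans h1); rewrite -cE expRM_natl.
  by rewrite lerXn2r ?nnegrE ?expR_ge0 ?coshR_le_expR // (le_trans ler01) ?coshR_ge1.
split.
  rewrite expr0 -p_sum1; apply: ler_sum => k _.
  by rewrite /walk big_ord0 phi00 sqrtr0 mulr0 coshR0 mulr1.
elim=> [|m IH].
  (* The first step need not be centered, but it starts at 0, so phi (d 0) <= D b^2 suffices. *)
  rewrite expr1 -[leRHS]mul1r -p_sum1 mulr_suml; apply: ler_sum => k _.
  rewrite ler_wpM2l //; apply: ler_coshR.
  rewrite walkS /walk big_ord0 add0r exprMn sqr_sqrtr // cE ler_wpM2l ?sqr_ge0 //.
  exact: le_trans (dD 0%N k).
have a0 x : 0 <= l * Num.sqrt (phi x) by rewrite mulr_ge0 ?sqrtr_ge0.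
(* The slope depends on the current position alone, hence is constant on the classes of the
   history. *)
pose kap x := s2val (cid2 (coshR_chord (a0 x) c0)).
have kap0 x : 0 <= kap x by rewrite /kap; case: cid2.
have kapP x : forall q z, `|q| <= 2 * (l * Num.sqrt (phi x) * c) ->
    z ^+ 2 <= (l * Num.sqrt (phi x)) ^+ 2 + q + c ^+ 2 ->
    coshR z <= coshR (l * Num.sqrt (phi x)) * coshR c + q * kap x.
  by rewrite /kap; case: cid2.
have step k : coshR (l * Num.sqrt (phi (walk d m.+2 k))) <=
    coshR (l * Num.sqrt (phi (walk d m.+1 k))) * coshR c +
    (l ^+ 2 * kap (walk d m.+1 k)) * psi (walk d m.+1 k) (d m.+1 k).
  rewrite (walkS d m.+1); set x := walk d m.+1 k; set y := d m.+1 k.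
  rewrite (mulrAC (l ^+ 2)); apply: kapP.
    (* The bound |psi| <= 2 sqrt (D phi) |y| is exactly what places the cross term in the range of
       the chord. *)
    rewrite normrM ger0_norm ?sqr_ge0 //.
    have -> : 2 * (l * Num.sqrt (phi x) * c) = l ^+ 2 * (2 * (Num.sqrt (phi x) * Num.sqrt D *
      b)).
      by rewrite /c; ring.
    rewrite ler_wpM2l ?sqr_ge0 // -ler_sqr ?nnegrE ?mulr_ge0 ?sqrtr_ge0 //.
    rewrite real_normK ?num_real //.
    apply: (le_trans (sqr_dirder_le D_gt0 norm_le_phi phi_smooth x y)).
    rewrite !exprMn !sqr_sqrtr ?(ltW D_gt0) //.
    have := dD m.+1 k; rewrite -/y => /(ler_wpM2l (phi0 x)); nra.
  rewrite cE !exprMn !sqr_sqrtr // -!mulrDr ler_wpM2l ?sqr_ge0 //.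
  apply: (le_trans (phi_le_dirder phi_smooth x y)).
  by rewrite lerD2l dD.
apply: (@le_trans _ _ (\sum_k (p k * coshR (l * Num.sqrt (phi (walk d m.+1 k))) * coshR c +
    p k * ((l ^+ 2 * kap (walk d m.+1 k)) * psi (walk d m.+1 k) (d m.+1 k))))).
  by apply: ler_sum => k _; rewrite -mulrA -mulrDr ler_wpM2l.
rewrite big_split /= [in leRHS]exprSr -[leRHS]addr0; apply: lerD.
  rewrite -(mulr_suml _ _ (fun k => p k * coshR (l * Num.sqrt (phi (walk d m.+1 k))))).
  by rewrite ler_wpM2r // (le_trans ler01) ?coshR_ge1.
have [hm had hmean] := hd.
apply: (sum_dirder_cond_le0 (h := h m.+1)) => [k|k k' e|v].
- by rewrite mulr_ge0 ?sqr_ge0.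
- by rewrite (walk_adapted hd e).
- exact: hmean.
Qed.

(** The quadratic counterpart of [cosh_walk_bound]: [phi_le_dirder] is summed over the steps and the
    psi terms average to at most 0. The first step is again bounded directly. *)
Lemma phi_walk_bound (h : nat -> K -> H) (d : nat -> K -> B) n :
  finite_martingale_difference p h d ->
  \sum_k p k * phi (walk d n k) <=
    D * \sum_(i < n) \sum_k p k * `|d i k| ^+ 2.
Proof.
move=> hd; have phi0 x : 0 <= phi x by apply: phi_ge0.
case: n => [|n].
  rewrite big_ord0 mulr0 big1 // => k _; rewrite /walk big_ord0.
  apply/eqP; rewrite mulf_eq0; apply/orP; right.
  by rewrite eq_le phi0 andbT (le_trans (phi_le_norm 0)) // normr0 expr0n mulr0.
elim: n => [|n IH].
  rewrite big_ord1 mulr_sumr; apply: ler_sum => k _.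
  by rewrite walkS /walk big_ord0 add0r mulrCA ler_wpM2l.
rewrite big_ord_recr mulrDr /=.
have [hm had hmean] := hd.
have H1 : \sum_k p k * (1 * psi (walk d n.+1 k) (d n.+1 k)) <= 0.
  apply: (sum_dirder_cond_le0 (h := h n.+1)) => [k|k k' e|v] //.
    by rewrite (walk_adapted hd e).
  exact: hmean.
apply: le_trans (lerD IH (lexx _)).
rewrite -[leRHS]addr0; apply: le_trans (lerD (lexx _) H1).
rewrite mulr_sumr -!big_split; apply: ler_sum => k _ /=.
rewrite walkS mul1r (mulrCA D) -!mulrDr ler_wpM2l // addrAC.
exact: (phi_le_dirder phi_smooth).
Qed.

(** The test at time i looks at the positions 0 to i only, all of which precede the step [d i]; the
    walk freezes as soon as its norm exceeds r. *)
Definition stopped (r : R) (d : nat -> K -> B) (i : nat) (k : K) : B :=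
  if [forall j : 'I_i.+1, `|walk d j k| <= r] then d i k else 0.

Lemma finite_martingale_difference_stopped r (h : nat -> K -> H) d :
  finite_martingale_difference p h d ->
  finite_martingale_difference p h (stopped r d).
Proof.
move=> hd; have [hm had hmean] := hd.
have hle i j k k' : (j <= i)%N -> h i k = h i k' -> h j k = h j k'.
  elim: i => [|i IH]; first by rewrite leqn0 => /eqP ->.
  by rewrite leq_eqVlt => /orP[/eqP -> //|ji /hm]; exact: IH.
have hok i k k' : h i k = h i k' ->
    [forall j : 'I_i.+1, `|walk d j k| <= r] = [forall j : 'I_i.+1, `|walk d j k'| <= r].
  move=> e; apply: eq_forallb => j; rewrite (walk_adapted hd (k' := k')) //.
  by apply: hle e; rewrite -ltnS.
split=> // [i k k' e|i v i0].
  by rewrite /stopped (hok i k k' (hm _ _ _ e)) (had _ _ _ e).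
have [k0 /eqP hk0|hv] := pickP (fun k => h i k == v); last by rewrite big_pred0.
rewrite -[RHS](@scaler0 R B (([forall j : 'I_i.+1, `|walk d j k0| <= r] : nat)%:R)).
rewrite -[in RHS](hmean i v i0) scaler_sumr; apply: eq_bigr => k /eqP hk.
rewrite /stopped (hok i k k0) ?hk ?hk0 //; case: ifP => _; first by rewrite scale1r.
by rewrite scaler0 scale0r.
Qed.

Lemma normr_stopped r d i k : 0 <= r -> `|stopped r d i k| <= `|d i k|.
Proof. by rewrite /stopped; case: ifP => // _; rewrite normr0. Qed.

(** After the exit all steps are 0, so the final position still witnesses it: an event about the
    maximum becomes one about the endpoint. *)
Lemma walk_stopped r (d : nat -> K -> B) n k : 0 <= r ->
  [exists j : 'I_n.+1, r < `|walk d j k|] -> r < `|walk (stopped r d) n k|.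
Proof.
move=> r0; pose ok i := [forall j : 'I_i.+1, `|walk d j k| <= r].
have nok i : [exists j : 'I_i.+1, r < `|walk d j k|] = ~~ ok i.
  by rewrite negb_forall; apply: eq_existsb => j; rewrite ltNge.
suff [_] : (ok n -> walk (stopped r d) n k = walk d n k) /\
  (~~ ok n -> r < `|walk (stopped r d) n k|) by rewrite nok.
elim: n => [|n [IH1 IH2]].
  split; first by rewrite /walk !big_ord0.
  by rewrite -nok => /existsP[j]; rewrite ord1 /walk big_ord0 normr0 ltNge r0.
have okS : ok n.+1 = ok n && (`|walk d n.+1 k| <= r).
  apply/forallP/andP => [H1|[/forallP H1 H2] j].
    split; last exact: (H1 ord_max).
    by apply/forallP => j; exact: (H1 (widen_ord (leqnSn _) j)).
  have := ltn_ord j; rewrite ltnS leq_eqVlt => /orP[/eqP ->//|jn].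
  exact: (H1 (Ordinal jn)).
rewrite walkS {2 4}/stopped -/(ok n) okS; case: (boolP (ok n)) => okn /=.
  rewrite IH1 // -walkS; split=> //; by rewrite -ltNge.
by split=> // _; rewrite addr0; exact: IH2.
Qed.

(** Markov's inequality for cosh (l sqrt phi) at the end of the stopped walk, with cosh >= exp /
    2. *)
Lemma finite_martingale_tail_bounded (h : nat -> K -> H) (d : nat -> K -> B)
    (b r : R) n : finite_martingale_difference p h d -> 0 < b -> 0 < r ->
  (0 < n)%N -> (forall i k, `|d i k| <= b) ->
  \sum_(k | [exists j : 'I_n.+1, (r < `|walk d j k|)%R]) p k <=
    2 * expR (- (r ^+ 2 / (2 * n%:R * D * b ^+ 2))).
Proof.
move=> hd b0 r0 n0 db.
have n0' : 0 < n%:R :> R by rewrite ltr0n.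
(* The minimizer of n l^2 D b^2 / 2 - l r. *)
have [l lE] : {l : R | l = r / (n%:R * D * b ^+ 2)} by exists (r / (n%:R * D * b ^+ 2)).
have l0 : 0 <= l by rewrite lE divr_ge0 ?mulr_ge0 ?sqr_ge0 // ltW.
have := cosh_walk_bound n (finite_martingale_difference_stopped r hd) (ltW b0) l0.
move/(_ (fun i k => le_trans (normr_stopped d i k (ltW r0)) (db i k))) => H1.
have H2 : expR (l * r) / 2 * \sum_(k | [exists j : 'I_n.+1, r < `|walk d j k|]) p k <=
    expR (n%:R * (l ^+ 2 * (D * b ^+ 2) / 2)).
  apply: le_trans H1; rewrite mulr_sumr big_mkcond; apply: ler_sum => k _.
  case: ifP => [hk|_]; last by rewrite mulr_ge0 // (le_trans ler01) ?coshR_ge1.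
  rewrite mulrC ler_wpM2l // (le_trans (expR_le_coshR _)) // ler_coshR //.
  rewrite !exprMn ler_wpM2l ?sqr_ge0 // sqr_sqrtr ?phi_ge0 //.
  apply: le_trans (norm_le_phi _); rewrite lerXn2r ?nnegrE ?(ltW r0) //.
  by apply/ltW/walk_stopped => //; exact: ltW.
rewrite mulrAC ler_pdivrMr // in H2.
rewrite -ler_pdivlMl ?expR_gt0 // -expRN in H2.
apply: (le_trans H2); rewrite mulrCA mulrA -expRD.
rewrite mulrC ler_pM2l // ler_expR le_eqVlt; apply/orP; left; apply/eqP.
by rewrite lE; field; rewrite !gt_eqF.
Qed.

(** Chebyshev's inequality, through phi, at the end of the stopped walk. *)
Lemma finite_martingale_tail_sqr (h : nat -> K -> H) (d : nat -> K -> B)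
    (r : R) n : finite_martingale_difference p h d -> 0 < r ->
  \sum_(k | [exists j : 'I_n.+1, (r < `|walk d j k|)%R]) p k <=
    D * (\sum_(i < n) \sum_k p k * `|d i k| ^+ 2) / r ^+ 2.
Proof.
move=> hd r0; rewrite ler_pdivlMr ?exprn_gt0 //.
apply: (@le_trans _ _ (D * \sum_(i < n) \sum_k p k * `|stopped r d i k| ^+ 2)).
  apply: le_trans (phi_walk_bound n (finite_martingale_difference_stopped r hd)).
  rewrite mulr_suml big_mkcond; apply: ler_sum => k _.
  case: ifP => [hk|_]; last by rewrite mulr_ge0 // phi_ge0.
  rewrite ler_wpM2l // (le_trans _ (norm_le_phi _)) //.
  rewrite lerXn2r ?nnegrE ?(ltW r0) //; apply/ltW/walk_stopped => //; exact: ltW.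
rewrite ler_pM2l //; apply: ler_sum => i _; apply: ler_sum => k _.
by rewrite ler_wpM2l // lerXn2r ?nnegrE // normr_stopped // ltW.
Qed.

End FiniteMartingale.

(** * Simple functions given by finite labels *)

Section FiniteLabels.
Context {d : measure_display} {T : measurableType d} {R : realType}
  (P : probability T R) {J : finType} (L : T -> J).
Hypothesis mL : forall j, measurable (L @^-1` [set j]).

Lemma measurable_label (C : set J) : measurable (L @^-1` C).
Proof.
rewrite (_ : _ @^-1` _ = \bigcup_(j in C) L @^-1` [set j]).
  by apply: fin_bigcup_measurable => // ; exact: finite_finset.
by apply/seteqP; split => [w Cw|w [j Cj /= e]]; [exists (L w)|rewrite /= e].
Qed.

Lemma fin_num_label (A : set T) (C : set J) : measurable A ->
  P (A `&` L @^-1` C) \is a fin_num.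
Proof.
by move=> mA; apply: fin_num_measure; apply: measurableI => //; exact: measurable_label.
Qed.


Lemma integral_label (A : set T) (g : J -> R) : measurable A ->
  (forall j, 0 <= g j) ->
  (\int[P]_(w in A) (g (L w))%:E)%E =
    (\sum_j fine (P (A `&` L @^-1` [set j])) * g j)%:E.
Proof.
move=> mA g0.
under eq_integral.
  move=> w _.
  rewrite (_ : (g (L w))%:E = \sum_j (g j)%:E * (\1_(L @^-1` [set j]) w)%:E)%E.
    over.
  rewrite (bigD1 (L w)) //= indicE mem_set // mule1 big1 ?adde0 // => j jw.
  by rewrite indicE memNset ?mule0 //= => jLw; move: jw; rewrite jLw eqxx.
rewrite ge0_integral_sum //=.
- rewrite -sumEFin; apply: eq_bigr => j _.
  rewrite ge0_integralZl //=.
  + rewrite integral_indic // EFinM muleC setIC fineK //.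
    exact: fin_num_label.
  + apply/measurable_EFinP; exact: measurable_indic.
  + by rewrite lee_fin.
- move=> j; apply: emeasurable_funM => //.
  apply/measurable_EFinP; exact: measurable_indic.
- by move=> j w _; rewrite mule_ge0 // lee_fin.
Qed.

Lemma probability_label (A : set T) (C : pred J) : measurable A ->
  P (A `&` [set w | C (L w)]) =
    (\sum_(j | C j) fine (P (A `&` L @^-1` [set j])))%:E.
Proof.
move=> mA; have := integral_label mA (g := fun j => (C j)%:R).
rewrite (_ : \sum_j _ * _ = \sum_(j | C j) fine (P (A `&` L @^-1` [set j]))).
  move=> <- //; rewrite setIC -integral_indic //; last exact: (measurable_label [set j | C j]).
  by apply: eq_integral => w _; rewrite indicE mem_setE.
by rewrite [RHS]big_mkcond; apply: eq_bigr => j _; case: (C j); rewrite ?mulr1 ?mulr0.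
Qed.

Lemma fimfun_label (B : choiceType) (v : J -> B) :
  exists s : {fimfun T >-> B}, forall w, s w = v (L w).
Proof.
have fin : finite_set (range (v \o L)).
  apply: (@sub_finite_set _ _ (v @` [set: J])).
    by move=> _ [w _ <-]; exists (L w).
  by apply: finite_image; exact: finite_finset.
pose m := @FiniteImage.Build _ _ (v \o L) fin.
pose s : {fimfun T >-> B} := HB.pack (v \o L) m.
by exists s.
Qed.

Context {B : completeNormedModType R}.

Lemma borel_measurable_label (v : J -> B) :
  borel_measurable_wrt (@measurable d T) (v \o L).
Proof. by move=> U _; exact: (measurable_label (v @^-1` U)). Qed.

(** [v] may take one value on several labels, so a fiber of [s] is a union of fibers of [L] and the
    sum is regrouped. *)
Lemma simple_integral_label (s : {fimfun T >-> B}) (v : J -> B) (A : set T) :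
  (forall w, s w = v (L w)) -> measurable A ->
  simple_integral P A s = \sum_j fine (P (A `&` L @^-1` [set j])) *: v j.
Proof.
move=> sv mA; pose r := undup [seq v j | j <- enum J].
have vr j : v j \in r by rewrite mem_undup map_f // mem_enum.
have fib y : A `&` s @^-1` [set y] = A `&` [set w | v (L w) == y].
  by apply/seteqP; split => w /= [Aw]; rewrite sv => /eqP.
rewrite /simple_integral (@fsbig_fwiden _ _ _ _ r) ?undup_uniq //; last 2 first.
- by move=> _ [w _ <-]; rewrite /= sv.
- move=> y [/= _ ny]; rewrite fib (_ : _ `&` _ = set0) ?measure0 /= ?scale0r //.
  by apply/seteqP; split => // w [_ /= /eqP e]; case: ny; exists w => //; rewrite sv.
rewrite (eq_bigr (fun y => \sum_(j | v j == y) fine (P (A `&` L @^-1` [set j])) *: v j));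
  last first.
  move=> y _; rewrite fib (probability_label (fun j => v j == y)) //= scaler_suml.
  by apply: eq_bigr => j /eqP ->.
under eq_bigr do rewrite big_mkcond.
rewrite exchange_big /=; apply: eq_bigr => j _.
rewrite (bigD1_seq (v j)) ?undup_uniq //= eqxx big1 ?addr0 // => y.
by rewrite eq_sym => /negbTE ->.
Qed.

End FiniteLabels.

(** * Integrals of simple functions and distances to them *)

Section SimpleIntegral.
Context {d : measure_display} {T : measurableType d} {R : realType}
  (P : probability T R) {B : completeNormedModType R}.
Implicit Types (X : T -> B) (s : {fimfun T >-> B}) (A : set T).

Lemma measurable_fun_norm_borel X (b : B) :
  borel_measurable_wrt (@measurable d T) X ->
  measurable_fun [set: T] (fun w => `|b - X w| : R).
Proof.
move=> mX; apply: (measurability _ (RGenOInfty.measurableE R)) => //.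
move=> _ [_ [x ->] <-]; rewrite setTI.
rewrite (_ : _ @^-1` _ = X @^-1` [set c | x < `|b - c|]); last first.
  by apply/seteqP; split => w /=; rewrite in_itv /= andbT.
apply: mX; apply: sub_sigma_algebra.
rewrite (_ : [set _ | _] = (fun c => `|b - c|) @^-1` [set t | x < t]) //.
apply: open_comp; last exact: open_gt.
move=> c _; apply: (@cvg_norm _ B); apply: cvgB; [exact: cvg_cst|exact: cvg_id].
Qed.

Lemma measurable_norm_gt X (t : R) :
  borel_measurable_wrt (@measurable d T) X ->
  measurable [set w | t < `|X w|].
Proof.
move=> mX; have := measurable_fun_norm_borel 0 mX.
move=> /(_ measurableT `]t, +oo[%classic (measurable_itv _)); rewrite setTI.
congr measurable; apply/seteqP; split => w /=; by rewrite in_itv /= andbT sub0r normrN.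
Qed.

(** On each fiber of [L] the first term is constant, so the distance of [X] to a fixed point is
    enough; this avoids the measurability of a difference of Borel maps. *)
Lemma measurable_fun_norm_label_sub (J : finType) (L : T -> J) (v : J -> B) X :
  (forall j, measurable (L @^-1` [set j])) ->
  borel_measurable_wrt (@measurable d T) X ->
  measurable_fun [set: T] (fun w => `|v (L w) - X w| : R).
Proof.
move=> mL mX _ Y mY; rewrite setTI.
rewrite (_ : _ @^-1` _ = \bigcup_(j in [set: J])
    (L @^-1` [set j] `&` (fun w => `|v j - X w|) @^-1` Y)).
  apply: fin_bigcup_measurable => [|j _]; first exact: finite_finset.
  apply: measurableI => //; rewrite -[_ @^-1` _]setTI.
  exact: measurable_fun_norm_borel.
apply/seteqP; split => [w /= Yw|w /= [j _ [/= e]]]; first by exists (L w).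
by rewrite e.
Qed.

Lemma fimfun_as_label s : borel_measurable_wrt (@measurable d T) s ->
  exists (J : finType) (L : T -> J) (v : J -> B),
    (forall j, measurable (L @^-1` [set j])) /\ (forall w, s w = v (L w)).
Proof.
move=> ms; have h w : s w \in fset_set (range s).
  by rewrite in_fset_set ?mem_set //; exact: fimfunP.
exists (fset_set (range s)), (fun w => [` h w]%fset), val; split=> // j.
rewrite (_ : _ @^-1` _ = s @^-1` [set val j]).
  apply: ms; rewrite -[X in <<s _ >> X]setCK -setTD; apply: sigma_algebraCD.
  apply: sub_sigma_algebra; apply: closed_openC.
  exact/accessible_closed_set1/hausdorff_accessible/norm_hausdorff.
by apply/seteqP; split => [w /= <-//|w /= e]; exact: val_inj.
Qed.

(** The pairs of labels form a common refinement, over which both integrals are sums with the same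
    weights. *)
Lemma norm_simple_integralB s1 s2 A :
  borel_measurable_wrt (@measurable d T) s1 ->
  borel_measurable_wrt (@measurable d T) s2 -> measurable A ->
  (`|simple_integral P A s1 - simple_integral P A s2|%:E <=
   \int[P]_(w in A) (`|s1 w - s2 w|%R)%:E)%E.
Proof.
move=> /fimfun_as_label[J1 [L1 [v1 [m1 e1]]]] /fimfun_as_label[J2 [L2 [v2 [m2 e2]]]] mA.
pose L w := (L1 w, L2 w).
have mL j : measurable (L @^-1` [set j]).
  case: j => j1 j2; rewrite (_ : _ @^-1` _ = L1 @^-1` [set j1] `&` L2 @^-1` [set j2]).
    exact: measurableI.
  by apply/seteqP; split => [w /= []|w /= [<- <-]].
rewrite (simple_integral_label P mL (v := v1 \o fst)) //.
rewrite (simple_integral_label P mL (v := v2 \o snd)) //.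
have -> : (\int[P]_(w in A) (`|s1 w - s2 w|%R)%:E =
    \int[P]_(w in A) ((fun j => `|v1 j.1 - v2 j.2|) (L w))%:E)%E.
  by apply: eq_integral => w _; rewrite e1 e2.
rewrite (integral_label P mL mA (g := fun j => `|v1 j.1 - v2 j.2|)) //.
rewrite lee_fin -sumrB (le_trans (ler_norm_sum _ _ _)) //.
apply: ler_sum => j _; rewrite -scalerBr normrZ ger0_norm //.
by rewrite fine_ge0.
Qed.

Lemma simple_integral_cst0 A : simple_integral P A (cst 0 : {fimfun T >-> B}) = 0.
Proof.
rewrite /simple_integral fsbig1 // => y [w _ <-].
by rewrite scaler0.
Qed.

Lemma borel_measurable_cst (G : set (set T)) (b : B) :
  sigma_algebra [set: T] G -> borel_measurable_wrt G (fun=> b).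
Proof.
move=> [G0 GC _] U _; have [Ub|Ub] := pselect (U b).
  rewrite (_ : _ @^-1` _ = [set: T] `\` set0); first exact: GC.
  by apply/seteqP; split => // w _; split.
by rewrite (_ : _ @^-1` _ = set0) //; apply/seteqP; split.
Qed.

End SimpleIntegral.

(** * Simple functions near a variable with vanishing conditional expectation *)

Section CenteredConditionalExpectation.
Context {d : measure_display} {T : measurableType d} {R : realType}
  (P : probability T R) {B : completeNormedModType R}.

Lemma borel_measurable_wrt_sub (G G' : set (set T)) (X : T -> B) :
  G `<=` G' -> borel_measurable_wrt G X -> borel_measurable_wrt G' X.
Proof. by move=> GG' mX U /mX /GG'. Qed.

Lemma simple_integral_approx (s : nat -> {fimfun T >-> B}) (A : set T)
    (X : T -> B) (v : B) (e : R) : 0 < e ->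
  (\int[P]_(w in A) (`|s n w - X w|%R)%:E)%E @[n --> \oo] --> 0%E ->
  simple_integral P A (s n) @[n --> \oo] --> v ->
  exists n, (\int[P]_(w in A) (`|s n w - X w|%R)%:E < e%:E)%E /\
    `|v - simple_integral P A (s n)| < e.
Proof.
move=> e0 h1 h2; have h1' : \forall n \near \oo,
    (\int[P]_(w in A) (`|s n w - X w|%R)%:E < e%:E)%E.
  by apply: (h1 [set x | (x < e%:E)%E]); apply: open_nbhs_nbhs; split; [exact:
    open_ereal_lt_ereal|rewrite /= lte_fin].
have h2' : \forall n \near \oo, `|v - simple_integral P A (s n)| < e.
  by move/cvgrPdist_lt : h2; apply.
have [n _ hn] : \forall n \near \oo, (\int[P]_(w in A) (`|s n w - X w|%R)%:E < e%:E)%E /\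
    `|v - simple_integral P A (s n)| < e by near=> n; split; near: n.
by exists n; exact: (hn n (leqnn n)).
Unshelve. all: by end_near.
Qed.

(** As Y = 0 almost everywhere, the simple functions approximating Y over A have L^1 norms tending
    to 0, and so do their integrals. *)
Lemma bochner_integral_ae0 (A : set T) (Y : T -> B) (v : B) :
  measurable A -> borel_measurable_wrt (@measurable d T) Y ->
  {ae P, forall w, Y w = 0} -> is_bochner_integral P A Y v -> v = 0.
Proof.
move=> mA mY Y0 [s [ms cs cv]]; apply/eqP; rewrite -normr_le0.
apply/ler_addgt0Pr => e e0; rewrite add0r.
have [n [h1 h2]] := @simple_integral_approx s A Y v (e / 2) (divr_gt0 e0 (ltr0n _ 2)) cs cv.
rewrite -[X in `|X|]subr0; apply: (le_trans (ler_distD (simple_integral P A (s n)) _ _)).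
rewrite subr0 [leRHS]splitr lerD ?ltW //.
have [J [L [u [mL sE]]]] := fimfun_as_label (ms n).
have := norm_simple_integralB P (ms n)
  (borel_measurable_cst 0 (@sigma_algebra_measurable _ T) : borel_measurable_wrt measurable
    (cst 0 : {fimfun T >-> B})) mA.
rewrite simple_integral_cst0 subr0 -lte_fin => /le_lt_trans; apply.
apply: le_lt_trans h1; rewrite le_eqVlt; apply/orP; left; apply/eqP.
apply: ge0_ae_eq_integral => //.
- apply/measurable_EFinP/measurable_funTS.
  have := measurable_fun_norm_label_sub u mL (borel_measurable_cst 0
    (@sigma_algebra_measurable _ T)).
  by apply: eq_measurable_fun => w _; rewrite sE.
- apply/measurable_EFinP/measurable_funTS.
  have := measurable_fun_norm_label_sub u mL mY.
  by apply: eq_measurable_fun => w _; rewrite sE.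
- by move: Y0; apply: filterS => w /= ->.
Qed.

(** This is how a vanishing conditional expectation is used: X has integral 0 over A, so the
    integral of a simple function is that of its difference with X. *)
Lemma norm_sum_label_le (G : set (set T)) (X Y : T -> B) (A : set T)
    (J : finType) (L : T -> J) (v : J -> B) :
  G `<=` measurable -> borel_measurable_wrt (@measurable d T) X ->
  is_cond_expectation P G X Y -> {ae P, forall w, Y w = 0} -> G A ->
  (forall j, measurable (L @^-1` [set j])) ->
  (`|\sum_j fine (P (A `&` L @^-1` [set j])) *: v j|%:E <=
   \int[P]_(w in A) (`|v (L w) - X w|%R)%:E)%E.
Proof.
move=> Gm mX [mY _ /(_ A)] cX Y0 GA mL; have mA := Gm _ GA.
have [u [[s [ms cs cu]] /(bochner_integral_ae0 mA (borel_measurable_wrt_sub Gm mY) Y0) u0]]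
  := cX GA.
rewrite u0 in cu; have [f fE] := fimfun_label L v.
have mf : borel_measurable_wrt (@measurable d T) f.
  by rewrite (_ : FImFun.sort f = v \o L) ?funeqE //; exact: borel_measurable_label.
rewrite -(simple_integral_label P mL fE mA).
apply/lee_addgt0Pr => e e0.
have [n [h1 h2]] := simple_integral_approx (divr_gt0 e0 (ltr0n _ 2)) cs cu.
rewrite sub0r normrN in h2.
rewrite -[simple_integral _ _ f](subrK (simple_integral P A (s n))).
apply: (@le_trans _ _ (`|simple_integral P A f - simple_integral P A (s n)| +
  `|simple_integral P A (s n)|)%:E).
  by rewrite lee_fin ler_normD.
rewrite [in leRHS](splitr e) [in leRHS]EFinD addeA EFinD; apply: leeD; last by rewrite
  lee_fin ltW.
apply: (le_trans (norm_simple_integralB P mf (ms n) mA)).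
apply: le_trans (leeD (lexx _) (ltW h1)).
have [J' [L' [u' [mL' sE]]]] := fimfun_as_label (ms n).
rewrite -ge0_integralD //=.
- apply: ge0_le_integral => //=.
  + apply/measurable_EFinP/measurable_funTS.
    have := measurable_fun_norm_label_sub v mL (ms n).
    by apply: eq_measurable_fun => w _; rewrite fE.
  + apply/measurable_EFinP/measurable_funTS/measurable_funD.
      exact: measurable_fun_norm_label_sub.
    have := measurable_fun_norm_label_sub u' mL' mX.
    by apply: eq_measurable_fun => w _; rewrite sE.
  + move=> w _; rewrite -EFinD lee_fin fE (distrC (s n w)).
    exact: ler_distD.
- apply/measurable_EFinP/measurable_funTS.
  exact: measurable_fun_norm_label_sub.
- apply/measurable_EFinP/measurable_funTS.
  have := measurable_fun_norm_label_sub u' mL' mX.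
  by apply: eq_measurable_fun => w _; rewrite sE.
Qed.

End CenteredConditionalExpectation.

(** * The Walsh-Paley functional of a 2-smooth space *)

Section CoinSpace.
Context {R : realType}.

(** The uniform law on the numbers below 2^n. Every subset of [nat] is measurable, so measurability
    on this space is immediate. *)
Definition coin (n : nat) : set nat -> \bar R :=
  mscale ((2^-1 ^+ n : R)%:nng)
    (msum (fun k => \d_k : {measure set nat -> \bar R}) (2 ^ n)).

HB.instance Definition _ n := Measure.on (coin n).

Lemma coinE n A :
  coin n A = (2^-1 ^+ n * \sum_(k < 2 ^ n) (\1_A (k : nat) : R))%:E.
Proof.
by rewrite /coin /mscale /= /msum /= EFinM -sumEFin; congr (_ * _)%E.
Qed.

Let coinT n : coin n [set: nat] = 1%E.
Proof.
rewrite coinE (eq_bigr (fun=> 1)); last by move=> k _; rewrite indicE mem_set.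
by rewrite sumr_const card_ord natrX exprVn mulVf ?expf_neq0.
Qed.

HB.instance Definition _ n := Measure_isProbability.Build _ _ R (coin n) (coinT n).

Lemma coin_expectation n (f : nat -> R) : (forall k, 0 <= f k) ->
  ('E_(coin n)[f] = (2^-1 ^+ n * \sum_(0 <= k < 2 ^ n) f k)%:E)%E.
Proof.
move=> f0; rewrite unlock /coin ge0_integral_mscale //=; last by move=> k _; rewrite lee_fin.
rewrite ge0_integral_measure_sum //=; last by move=> k _; rewrite lee_fin.
rewrite EFinM big_mkord -sumEFin; congr (_ * _)%E; apply: eq_bigr => k _.
by rewrite integral_dirac //= diracT mul1e.
Qed.

End CoinSpace.

(** A finite Walsh-Paley martingale: at [WNode y l r] one toss moves by y and continues with l, or
    moves by - y and continues with r. *)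
Inductive wtree (B : Type) := WLeaf | WNode of B & wtree B & wtree B.
Arguments WLeaf {B}.

Section WalshTree.
Context {R : realType} {B : normedModType R}.
Implicit Type t : wtree B.

Fixpoint wdepth t := if t is WNode _ l r then (maxn (wdepth l) (wdepth r)).+1 else 0%N.

(** Expected squared norm of the endpoint minus D times the expected sum of squared increments,
    computed backwards along the tosses. *)
Fixpoint wval (D : R) t (x : B) : R :=
  if t is WNode y l r then
    (wval D l (x + y) + wval D r (x - y)) / 2 - D * `|y| ^+ 2
  else `|x| ^+ 2.

(* The binary digits of [k], from the lowest one up, are the coin tosses. *)
Fixpoint wstep t (i k : nat) : B :=
  if t is WNode y l r then
    if i is j.+1 then wstep (if odd k then r else l) j k./2
    else if odd k then - y else y
  else 0.

(** Digits 0 to i - 1 select the branch and digit i the sign. *)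
Lemma wstep_mod t i k k' : k = k' %[mod 2 ^ i.+1] -> wstep t i k = wstep t i k'.
Proof.
have oddm j : odd (j %% 2 ^ i.+1) = odd j.
  by rewrite [in RHS](divn_eq j (2 ^ i.+1)) oddD oddM oddX andbF.
elim: t i oddm k k' => [//|y l IHl r IHr] i oddm k k' e /=.
have ek : odd k = odd k' by rewrite -oddm e oddm.
rewrite ek; case: i oddm e => [//|i] oddm e.
suff e2 : k./2 = k'./2 %[mod 2 ^ i.+1].
  have oddi j : odd (j %% 2 ^ i.+1) = odd j.
    by rewrite [in RHS](divn_eq j (2 ^ i.+1)) oddD oddM oddX andbF.
  by case: (odd k'); [exact: (IHr _ oddi _ _ e2)|exact: (IHl _ oddi _ _ e2)].
move: e; rewrite -{1}(odd_double_half k) -{1}(odd_double_half k') ek.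
move/eqP; rewrite eqn_modDl => /eqP; rewrite -!muln2 expnSr -!muln_modl => /eqP.
by rewrite eqn_pmul2r // => /eqP.
Qed.

Lemma sum_double (V : nmodType) (f : nat -> V) m :
  \sum_(0 <= k < m.*2) f k = \sum_(0 <= k < m) (f k.*2 + f k.*2.+1).
Proof.
elim: m => [|m IH]; first by rewrite !big_geq.
by rewrite doubleS !big_nat_recr //= IH addrA.
Qed.

Lemma expn2S n : (2 ^ n.+1 = (2 ^ n).*2)%N.
Proof. by rewrite expnS mul2n. Qed.

(** Separating even and odd k conditions on the first toss. The bounds n and m are free so that
    subtrees of unequal depth are averaged over the same tosses. *)
Lemma wval_average (D : R) t x n m : (wdepth t <= n)%N -> (wdepth t <= m)%N ->
  2^-1 ^+ n * \sum_(0 <= k < 2 ^ n) (`|x + \sum_(i < m) wstep t i k| ^+ 2 -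
    D * \sum_(i < m) `|wstep t i k| ^+ 2) = wval D t x.
Proof.
elim: t x n m => [|y l IHl r IHr] x n m /=.
  move=> _ _; under eq_bigr.
    move=> k _; rewrite big1 // addr0 big1 => [|i _]; last by rewrite normr0 expr0n.
    rewrite mulr0 subr0; over.
  rewrite big_const_nat iter_addr_0 subn0 -(mulr_natl (`|x| ^+ 2)) natrX mulrA exprVn.
  by rewrite mulVf ?expf_neq0 // mul1r.
case: n => [//|n]; case: m => [//|m]; rewrite !ltnS !geq_max => /andP[ln rn] /andP[lm rm].
rewrite -(IHl (x + y) n m) // -(IHr (x - y) n m) // expn2S sum_double.
rewrite exprS -mulrDr -big_split /=.
have -> (a b : R) : 2^-1 ^+ n * a / 2 - b = 2^-1 * 2^-1 ^+ n * (a - 2 ^+ n * 2 * b).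
  have : 2^-1 ^+ n * 2 ^+ n = 1 :> R by rewrite -exprMn mulVf ?expr1n.
  move: (2^-1 ^+ n) (2 ^+ n) => p q h; rewrite mulrBr.
  rewrite (_ : 2^-1 * p * (q * 2 * b) = p * q * b); last by field.
  by rewrite h; field.
congr (_ * _).
have -> : 2 ^+ n * 2 * (D * `|y| ^+ 2) = \sum_(0 <= k < 2 ^ n) (2 * (D * `|y| ^+ 2)).
  by rewrite big_const_nat iter_addr_0 subn0 -(mulr_natl (2 * (D * `|y| ^+ 2))) natrX -mulrA.
rewrite -sumrB; apply: eq_bigr => k _.
rewrite !big_ord_recl /= !odd_double /= doubleK.
have E t j : \sum_(i < m) wstep t (0 + i) j = \sum_(i < m) wstep t i j by [].
have E2 t j : \sum_(i < m) `|wstep t (0 + i) j| ^+ 2 = \sum_(i < m) `|wstep t i j| ^+ 2 by [].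
by rewrite !E !E2 uphalf_double normrN !addrA; ring.
Qed.

(** A depends on the tosses 0 to i - 1, while toss i is a fair sign: once the first i tosses have
    been split off, y and - y cancel in pairs. *)
Lemma sum_wstep0 t i n (A : pred nat) : (wdepth t <= n)%N ->
  (forall k k', (k < 2 ^ n)%N -> (k' < 2 ^ n)%N -> k = k' %[mod 2 ^ i] -> A k = A k') ->
  \sum_(0 <= k < 2 ^ n | A k) wstep t i k = 0.
Proof.
elim: t i n A => [|y l IHl r IHr] i n A /=; first by rewrite big1.
case: n => [//|n]; rewrite ltnS geq_max => /andP[ln rn] hA.
rewrite big_mkcond expn2S sum_double.
under eq_bigr do rewrite /= odd_double /= doubleK uphalf_double.
case: i hA => [|i] hA.
  rewrite big_nat big1 // => k /andP[_ kn].
  rewrite (hA k.*2.+1 k.*2) ?modn1 // ?expn2S ?ltn_double // ?ltn_Sdouble //.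
  by case: ifP => _; rewrite ?addr0 // subrr.
have hmod k k' : k = k' %[mod 2 ^ i] -> k.*2 = k'.*2 %[mod 2 ^ i.+1].
  by move=> e; rewrite -!muln2 expnSr -!muln_modl e.
rewrite big_split /= -!big_mkcond /=.
rewrite (IHl i n (fun k => A k.*2)) // ?(IHr i n (fun k => A k.*2.+1)) ?addr0 //.
  move=> k k' kn kn' e; apply: hA; first by rewrite expn2S ltn_Sdouble.
    by rewrite expn2S ltn_Sdouble.
  by rewrite -(addn1 k.*2) -(addn1 k'.*2) -(modnDml k.*2) (hmod _ _ e) modnDml.
by move=> k k' kn kn' e; apply: hA; last exact: hmod; rewrite expn2S ltn_double.
Qed.

End WalshTree.

(** * Walsh-Paley martingales realized on the coin space *)

Section SmoothTree.
Context {R : realType} {B : completeNormedModType R}.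

(** The events decided by the first i - 1 tosses: index 1 belongs to the deterministic start, so
    toss j enters at index j + 2. Numbers from 2^n on have mass 0 and are left free. *)
Definition coin_algebra (n i : nat) : set (set nat) :=
  [set A | forall k k', (k < 2 ^ n)%N -> (k' < 2 ^ n)%N ->
    k = k' %[mod 2 ^ i.-1] -> A k -> A k'].

Lemma expn2_gt0 n : (0 < 2 ^ n)%N. Proof. by rewrite expn_gt0. Qed.

(* [coin n] is carried by the numbers below [2 ^ n]; the others are sent to 0
   so that the martingale takes finitely many values. *)
Definition coin_label n (k : nat) : 'I_(2 ^ n) :=
  insubd (Ordinal (expn2_gt0 n)) k.

Definition coin_martingale (n : nat) (t : wtree B) (x : B) (i k : nat) : B :=
  if i is j.+2 then wstep t j (coin_label n k) else x.

Lemma coin_labelK n k : (k < 2 ^ n)%N -> coin_label n k = k :> nat.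
Proof. by move=> kn; rewrite /coin_label val_insubd kn. Qed.

Lemma coin_label_prob n (A : set nat) (j : 'I_(2 ^ n)) :
  fine (@coin R n (A `&` coin_label n @^-1` [set j])) =
  2^-1 ^+ n * \1_A (j : nat).
Proof.
rewrite coinE /=; congr (_ * _); rewrite (bigD1 j) //= big1 ?addr0 => [|k kj].
  rewrite !indicE; congr (_%:R); congr nat_of_bool.
  apply/idP/idP => /set_mem => [[Aj _]|Aj]; apply/mem_set => //; split=> //=.
  by apply/val_inj; rewrite /= coin_labelK.
rewrite indicE memNset // => -[_ /= e]; move: kj.
by rewrite -e -(inj_eq val_inj) /= coin_labelK ?eqxx.
Qed.

Lemma sigma_coin_algebra n i : sigma_algebra [set: nat] (coin_algebra n i).
Proof.
split=> [k k'//|A hA k k' kn kn' e [_ nA]|A hA k k' kn kn' e [j _ Aj]].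
  by split=> // Ak'; apply: nA; apply: hA Ak' => //; rewrite e.
by exists j => //; apply: hA Aj.
Qed.

Lemma coin_Lp1 n (X : nat -> B) : Lp_space (@coin R n) 1 X.
Proof.
split; first by [].
by rewrite coin_expectation ?ltry // => k; exact: powR_ge0.
Qed.

Lemma coin_martingale_difference n t x : (wdepth t <= n)%N ->
  martingale_difference (@coin R n) (coin_martingale n t x) (coin_algebra n).
Proof.
move=> tn; split.
- split=> [i _|i _ //|i j i1 ij A hA k k' kn kn' e]; first exact: sigma_coin_algebra.
  apply: hA => //; move: e; rewrite -(subnK (_ : i.-1 <= j.-1)%N).
    by rewrite expnD => /(congr1 (modn^~ (2 ^ i.-1)%N)); rewrite !modn_dvdm ?dvdn_mull.
  by rewrite -!subn1 leq_sub2r.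
- move=> i i1; split; last exact: coin_Lp1.
  move=> U _ k k' kn kn' e /=; rewrite /coin_martingale; case: i i1 e => [//|[//|i]] _ e.
  by rewrite !coin_labelK // (wstep_mod _ e).
- case=> [//|[//|i]] _; exists (fun=> 0); split; last exact: aeW.
  split; [|exact: coin_Lp1|].
    by apply: borel_measurable_cst; exact: sigma_coin_algebra.
  (* Both integrals are 0, and a finitely valued map serves as its own approximating sequence. *)
  move=> A hA; exists 0; split.
    have mL (j : 'I_(2 ^ n)) : measurable (coin_label n @^-1` [set j]) by [].
    pose v (j : 'I_(2 ^ n)) := wstep t i j.
    have [s sE] := fimfun_label (coin_label n) v.
    exists (fun=> s); split=> //.
      rewrite (_ : (fun _ => _) = cst 0%E); first exact: cvg_cst.
      apply/funext => m; rewrite (eq_integral (cst 0%E)) ?integral0 // => k _.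
      by rewrite sE /v subrr normr0.
    rewrite (_ : (fun _ => _) = cst 0); first exact: cvg_cst.
    apply/funext => m; rewrite (simple_integral_label _ mL sE) //=.
    under eq_bigr do rewrite coin_label_prob -scalerA.
    rewrite -scaler_sumr -[RHS](scaler0 _ (2^-1 ^+ n)); congr (_ *: _).
    rewrite -[RHS](@sum_wstep0 _ _ t i n (fun k => `[< A k >]) tn); last first.
      move=> k k' kn kn' e; apply: asbool_equiv_eq.
      by split; apply: hA => //=; rewrite e.
    rewrite [RHS]big_mkcond big_mkord; apply: eq_bigr => k _.
    rewrite indicE; case: asboolP => Ak.
      by rewrite mem_set // scale1r.
    by rewrite memNset // scale0r.
  exists (fun=> cst 0); split=> //.
    rewrite (_ : (fun _ => _) = cst 0%E); first exact: cvg_cst.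
    by apply/funext => m; rewrite (eq_integral (cst 0%E)) ?integral0 // => k _; rewrite subrr
      normr0.
  rewrite (_ : (fun _ => _) = cst 0); first exact: cvg_cst.
  by apply/funext => m; exact: simple_integral_cst0.
Qed.

(** Smoothness is applied to the start followed by n tosses; moving the increments to the left
    leaves the contribution D |x|^2 of the start. *)
Lemma wval_le (D : R) (t : wtree B) (x : B) : rD_smooth B 2 D -> wval D t x <= D * `|x| ^+ 2.
Proof.
move=> [_ hD]; set n := wdepth t.
have := hD _ _ (@coin R n) _ _ (coin_martingale_difference x (leqnn _ : wdepth t <= n)%N)
  n.+1 isT.
rewrite coin_expectation; last by move=> k; exact: powR_ge0.
have -> : (\sum_(1 <= i < n.+2) 'E_(@coin R n)[fun w => (`|coin_martingale n t x i w| `^ 2)%R] =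
   (\sum_(1 <= i < n.+2) (2^-1 ^+ n * \sum_(0 <= k < 2 ^ n) `|coin_martingale n t x i k| `^
     2)%R)%:E)%E.
  rewrite -sumEFin; apply: eq_bigr => i _.
  by rewrite coin_expectation // => k; exact: powR_ge0.
rewrite -EFinM lee_fin -(wval_average D x (leqnn _ : wdepth t <= n)%N (leqnn _ : wdepth t <=
  n)%N).
have E i : \sum_(0 <= k < 2 ^ n) `|coin_martingale n t x i.+2 k| `^ 2 = \sum_(0 <= k < 2 ^ n)
  `|wstep t i k| ^+ 2.
  by rewrite big_nat [RHS]big_nat; apply: eq_bigr => k /andP[_ kn]; rewrite /= coin_labelK //
    powR_mulrn.
have E1 : \sum_(0 <= k < 2 ^ n) `|x| `^ 2 = 2 ^+ n * `|x| ^+ 2.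
  by rewrite big_const_nat iter_addr_0 subn0 -(mulr_natl (`|x| `^ 2)) natrX powR_mulrn.
have E2 : \sum_(0 <= k < 2 ^ n) `|\sum_(1 <= i < n.+2) coin_martingale n t x i k| `^ 2 =
  \sum_(0 <= k < 2 ^ n) `|x + \sum_(i < n) wstep t i k| ^+ 2.
  rewrite big_nat [RHS]big_nat; apply: eq_bigr => k /andP[_ kn].
  rewrite big_nat_recl //= big_add1 /= big_mkord powR_mulrn //.
  by congr (`|x + _| ^+ 2); apply: eq_bigr => i _; rewrite coin_labelK.
rewrite E2 big_nat_recl //= E1 big_add1 /= [X in _ <= D * (_ + X)]big_mkord.
under [X in _ <= D * (_ + X)]eq_bigr do rewrite E.
rewrite sumrB mulrBr => H; rewrite lerBlDr; apply: (le_trans H).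
rewrite mulrA -exprMn mulVf // expr1n mul1r mulrDr lerD2l -mulr_sumr -mulr_sumr exchange_big /=.
by rewrite mulrCA.
Qed.

End SmoothTree.

(** * The majorant phi as a supremum over trees *)

Section SmoothFunctional.
Context {R : realType} {B : completeNormedModType R} (D : R).
Hypothesis hD : rD_smooth B 2 D.

Definition walsh_sup (x : B) : R := sup [set wval D t x | t in [set: wtree B]].

Lemma walsh_sup_ubound t (x : B) : wval D t x <= walsh_sup x.
Proof.
apply: ub_le_sup; last by exists t.
by exists (D * `|x| ^+ 2) => _ [u _ <-]; exact: wval_le.
Qed.

Lemma walsh_sup_le (x : B) (c : R) :
  (forall t, wval D t x <= c) -> walsh_sup x <= c.
Proof.
move=> hc; apply: ge_sup; first by exists (wval D WLeaf x), WLeaf.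
by move=> _ [t _ <-].
Qed.

Lemma norm_le_walsh_sup (x : B) : `|x| ^+ 2 <= walsh_sup x.
Proof. exact: (walsh_sup_ubound WLeaf). Qed.

Lemma walsh_sup_le_norm (x : B) : walsh_sup x <= D * `|x| ^+ 2.
Proof. by apply: walsh_sup_le => t; exact: wval_le. Qed.

(** The trees following the two outcomes of the first toss are chosen independently, so the two
    suprema are taken one after the other over [WNode y l r]. *)
Lemma walsh_sup_smooth (x y : B) :
  walsh_sup (x + y) + walsh_sup (x - y) <= 2 * walsh_sup x + 2 * D * `|y| ^+ 2.
Proof.
rewrite -lerBrDr; apply: walsh_sup_le => l.
rewrite lerBrDl -lerBrDr; apply: walsh_sup_le => r.
have := walsh_sup_ubound (WNode y l r) x; rewrite /=; lra.
Qed.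

End SmoothFunctional.

(** * Averages over classes and moments from tails *)

Section ConditionalAverage.
Context {R : realType} {B : normedModType R} {K H : finType} (p : K -> R).
Hypothesis p_ge0 : forall k, 0 <= p k.
Implicit Types (h : K -> H) (f g : K -> B).

Definition class_weight h (v : H) : R := \sum_(k | h k == v) p k.

(* junk value 0 on the classes of weight 0 *)
Definition condavg h f (k : K) : B :=
  (class_weight h (h k))^-1 *: \sum_(k' | h k' == h k) p k' *: f k'.

Lemma class_weight_ge0 h v : 0 <= class_weight h v.
Proof. exact: sumr_ge0. Qed.

Lemma class_weight0 h v k : class_weight h v = 0 -> h k == v -> p k = 0.
Proof.
move=> w0 hk; apply/eqP; rewrite eq_le p_ge0 andbT -w0 /class_weight (bigD1 k) //=.
by rewrite lerDl sumr_ge0.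
Qed.

Lemma condavg_eq h f k k' : h k = h k' -> condavg h f k = condavg h f k'.
Proof. by rewrite /condavg => ->. Qed.

Lemma sum_class_condavg h f v :
  \sum_(k | h k == v) p k *: condavg h f k = \sum_(k | h k == v) p k *: f k.
Proof.
have [w0|w0] := eqVneq (class_weight h v) 0.
  by rewrite !big1 // => k /(class_weight0 w0) ->; rewrite scale0r.
rewrite (eq_bigr (fun k => p k *: ((class_weight h v)^-1 *: \sum_(k' | h k' == v) p k' *: f
  k'))).
  by rewrite -scaler_suml scalerA mulfV // scale1r.
by move=> k /eqP hk; rewrite /condavg hk.
Qed.

Lemma condavgD h f g k :
  condavg h (fun k => f k + g k) k = condavg h f k + condavg h g k.
Proof.
rewrite /condavg -scalerDr -big_split; congr (_ *: _).
by apply: eq_bigr => j _; rewrite scalerDr.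
Qed.

Lemma sum_class_centered h f v :
  \sum_(k | h k == v) p k *: (f k - condavg h f k) = 0.
Proof.
under eq_bigr do rewrite scalerBr.
by rewrite sumrB sum_class_condavg subrr.
Qed.

Lemma normr_condavg_le h f (b : R) k : 0 <= b -> (forall k, `|f k| <= b) ->
  `|condavg h f k| <= b.
Proof.
move=> b0 fb; rewrite /condavg normrZ normfV (ger0_norm (class_weight_ge0 _ _)).
have [w0|w0] := eqVneq (class_weight h (h k)) 0; first by rewrite w0 invr0 mul0r.
rewrite ler_pdivrMl ?lt0r ?w0 ?class_weight_ge0 //.
apply: (le_trans (ler_norm_sum _ _ _)); rewrite /class_weight mulr_suml.
by apply: ler_sum => j _; rewrite normrZ ger0_norm // ler_wpM2l.
Qed.

(** Exact because the average is constant on the class; this later turns the L^1 norm of the drift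
    into norms of class sums. *)
Lemma sum_class_normr_condavg h f v :
  \sum_(k | h k == v) p k * `|condavg h f k| = `|\sum_(k | h k == v) p k *: f k|.
Proof.
have [w0|w0] := eqVneq (class_weight h v) 0.
  rewrite !big1 ?normr0 // => k /(class_weight0 w0) ->; first by rewrite scale0r.
  by rewrite mul0r.
rewrite (eq_bigr (fun k => p k * ((class_weight h v)^-1 * `|\sum_(k' | h k' == v) p k' *: f
  k'|))).
  by rewrite -mulr_suml mulrA mulfV // mul1r.
by move=> k /eqP hk; rewrite /condavg hk normrZ normfV (ger0_norm (class_weight_ge0 _ _)).
Qed.

(** Class by class, with c the norm of the average and w the weight: expand the sum of p (|f| - c)^2
    >= 0 and use that w c is at most the sum of p |f|. *)
Lemma sum_sqr_condavg_le h f :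
  \sum_k p k * `|condavg h f k| ^+ 2 <= \sum_k p k * `|f k| ^+ 2.
Proof.
rewrite (partition_big h xpredT) //= [leRHS](partition_big h xpredT) //=.
apply: ler_sum => v _; have [w0|w0] := eqVneq (class_weight h v) 0.
  by rewrite !big1 // => k /(class_weight0 w0) ->; rewrite mul0r.
have [k0 /eqP hk0|hv] := pickP (fun k => h k == v); last by rewrite !big_pred0.
rewrite (eq_bigr (fun k => p k * `|condavg h f k0| ^+ 2)); last first.
  by move=> k /eqP hk; rewrite (@condavg_eq h f k k0) // hk.
set c := `|condavg h f k0|; rewrite -mulr_suml -/(class_weight h v).
have c0 : 0 <= c by exact: normr_ge0.
have h1 : class_weight h v * c <= \sum_(k | h k == v) p k * `|f k|.
  rewrite /class_weight mulr_suml (eq_bigr (fun k => p k * `|condavg h f k|)).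
    rewrite sum_class_normr_condavg (le_trans (ler_norm_sum _ _ _)) //.
    by apply: ler_sum => j _; rewrite normrZ ger0_norm.
  by move=> k /eqP hk; rewrite (@condavg_eq h f k k0) // hk.
have h2 : 0 <= \sum_(k | h k == v) p k * (`|f k| - c) ^+ 2.
  by apply: sumr_ge0 => k _; rewrite mulr_ge0 ?sqr_ge0.
have h3 : \sum_(k | h k == v) p k * (`|f k| - c) ^+ 2 =
  \sum_(k | h k == v) p k * `|f k| ^+ 2 - 2 * c * \sum_(k | h k == v) p k * `|f k| +
  class_weight h v * c ^+ 2.
  rewrite /class_weight mulr_suml mulr_sumr -sumrB -big_split /=.
  by apply: eq_bigr => k _; ring.
rewrite h3 in h2; have := ler_wpM2l c0 h1; nra.
Qed.

Lemma sum_sqr_centered_le h f :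
  \sum_k p k * `|f k - condavg h f k| ^+ 2 <= 4 * \sum_k p k * `|f k| ^+ 2.
Proof.
have := sum_sqr_condavg_le h f.
suff : \sum_k p k * `|f k - condavg h f k| ^+ 2 <=
  2 * \sum_k p k * `|f k| ^+ 2 + 2 * \sum_k p k * `|condavg h f k| ^+ 2 by lra.
rewrite !mulr_sumr -big_split /=; apply: ler_sum => k _.
rewrite !(mulrCA 2) -mulrDr ler_wpM2l //.
have h1 := ler_normB (f k) (condavg h f k).
apply: (@le_trans _ _ ((`|f k| + `|condavg h f k|) ^+ 2)).
  by rewrite lerXn2r ?nnegrE // addr_ge0.
rewrite -subr_ge0 (_ : _ - _ = (`|f k| - `|condavg h f k|) ^+ 2 :> R) ?sqr_ge0 //.
ring.
Qed.

End ConditionalAverage.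

(** * Second moments from subexponential tails *)

Section TailMoment.
Context {R : realType}.

(* [3 / b] is where [t ^ 3 * exp (- t ^ b)] starts decreasing (as a function
   of [t ^ b]). *)
Lemma cube_expR_powR_le (a b s : R) : 0 < b -> 0 < a -> 1 <= s ->
  3 / b <= a `^ b ->
  s ^+ 3 * expR (- (s * a) `^ b) <= expR (- a `^ b).
Proof.
move=> b0 a0 s1 ha; have s0 : 0 < s by exact: lt_le_trans ltr01 s1.
have -> : s ^+ 3 = expR (3 * ln s) by rewrite expRM_natl lnK.
rewrite -expRD ler_expR powRM ?(ltW a0) ?(ltW s0) //.
have l0 : 0 <= ln s by rewrite ln_ge0.
have h1 : b * ln s <= s `^ b - 1.
  rewrite lerBrDl /powR gt_eqF // ; exact: expR_ge1Dx.
have h2 : 3 * ln s <= a `^ b * (b * ln s).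
  by rewrite mulrA ler_wpM2r // -ler_pdivrMr.
have h3 := ler_wpM2l (powR_ge0 a b) h1.
lra.
Qed.

(** The layer 2 (2^j a) < f <= 2 (2^(j+1) a) contributes at most 16 (2^j a)^2 times its tail, and
    [cube_expR_powR_le] makes these terms decay like 2^-j. Values up to 2 a are charged to the event
    f > 0, and 4 + 16 * 2 = 36. *)
Lemma sum_sqr_tail_le (K : finType) (p f : K -> R) (a u b C : R) :
  (forall k, 0 <= p k) -> (forall k, 0 <= f k) ->
  0 < b -> 0 < u -> u <= a -> 3 / b <= a `^ b -> 0 <= C ->
  \sum_(k | 0 < f k) p k <= C * expR (- u `^ b) ->
  (forall t, u <= t -> \sum_(k | 2 * t < f k) p k <= C * expR (- t `^ b)) ->
  \sum_k p k * f k ^+ 2 <= 36 * a ^+ 2 * (C * expR (- u `^ b)).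
Proof.
move=> p0 f0 b0 u0 ua ha C0 hu ht.
have a0 : 0 < a := lt_le_trans u0 ua.
(* [K] is finite, so [f] is bounded and finitely many layers suffice. *)
have [m hm] : exists m, forall k, f k <= 2 * (2 ^+ m * a).
  pose s := \sum_k f k; exists (Num.truncn (s / a)).+1 => k.
  have fs : f k <= s by rewrite /s (bigD1 k) //= lerDl sumr_ge0.
  have s0 : 0 <= s / a by rewrite divr_ge0 ?sumr_ge0 // ltW.
  have /andP[_ h1] := truncn_itv s0.
  have h2 : (Num.truncn (s / a)).+1%:R <= 2 ^+ (Num.truncn (s / a)).+1 :> R.
    by rewrite -natrX ler_nat ltnW // ltn_expl.
  have h3 : s <= 2 ^+ (Num.truncn (s / a)).+1 * a.
    by rewrite -ler_pdivrMr // (le_trans (ltW h1)).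
  apply: (le_trans fs); apply: (le_trans h3).
  by rewrite ler_peMl ?ler1n // mulr_ge0 ?exprn_ge0 ?(ltW a0).
have key k : p k * f k ^+ 2 <= 4 * a ^+ 2 * (if 0 < f k then p k else 0) +
    \sum_(j < m) 16 * (2 ^+ j * a) ^+ 2 * (if 2 * (2 ^+ j * a) < f k then p k else 0).
  have sge0 i : 0 <= \sum_(j < i) 16 * (2 ^+ j * a) ^+ 2 * (if 2 * (2 ^+ j * a) < f k then p
    k else 0).
    apply: sumr_ge0 => j _; apply: mulr_ge0; last by case: ifP.
    by rewrite mulr_ge0 ?sqr_ge0.
  have := hm k; elim: m {hm} => [|i IH] fk.
    rewrite big_ord0 addr0; case: ltP => fk0.
      rewrite expr0 mul1r in fk; rewrite (mulrC (p k)); apply: ler_wpM2r => //.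
      rewrite (_ : 4 * _ = (2 * a) ^+ 2); last by ring.
      by rewrite lerXn2r ?nnegrE // mulr_ge0 ?(ltW a0).
    have -> : f k = 0 by apply/eqP; rewrite eq_le fk0 f0.
    by rewrite expr0n !mulr0.
  rewrite big_ord_recr /=; case: (ltP (2 * (2 ^+ i * a)) (f k)) => fi; last first.
    by rewrite mulr0 addr0; exact: IH.
  apply: (@le_trans _ _ (16 * (2 ^+ i * a) ^+ 2 * p k)).
    rewrite (mulrC (p k)); apply: ler_wpM2r => //.
    rewrite (_ : 16 * _ = (2 * (2 ^+ i.+1 * a)) ^+ 2); last by rewrite (exprS 2 i); ring.
    by rewrite lerXn2r ?nnegrE // !mulr_ge0 ?exprn_ge0 ?(ltW a0).
  rewrite addrA lerDr; apply: addr_ge0; last exact: sge0.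
  by apply: mulr_ge0; [rewrite mulr_ge0 ?sqr_ge0|case: ifP].
apply: (@le_trans _ _ (4 * a ^+ 2 * \sum_(k | 0 < f k) p k +
    \sum_(j < m) 16 * (2 ^+ j * a) ^+ 2 * \sum_(k | 2 * (2 ^+ j * a) < f k) p k)).
  under [X in _ <= _ + X]eq_bigr do rewrite [in X in _ * X]big_mkcond mulr_sumr.
  rewrite [X in _ * X]big_mkcond mulr_sumr exchange_big -big_split /=.
  by apply: ler_sum => k _; exact: key.
set E := C * expR (- u `^ b); have E0 : 0 <= E by rewrite mulr_ge0 ?expR_ge0.
have hj j : 16 * (2 ^+ j * a) ^+ 2 * \sum_(k | 2 * (2 ^+ j * a) < f k) p k <=
    16 * a ^+ 2 * E * 2^-1 ^+ j.
  have s1 : 1 <= 2 ^+ j :> R by rewrite exprn_ege1 // ler1n.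
  have s0 : 0 < 2 ^+ j :> R by rewrite exprn_gt0.
  have h1 := ht (2 ^+ j * a) (le_trans ua (ler_peMl (ltW a0) s1)).
  have h2 := cube_expR_powR_le b0 a0 s1 ha.
  have h3 : expR (- a `^ b) <= expR (- u `^ b).
    by rewrite ler_expR lerN2 ge0_ler_powR ?nnegrE // ?ltW.
  apply: (@le_trans _ _ (16 * (2 ^+ j * a) ^+ 2 * (C * expR (- (2 ^+ j * a) `^ b)))).
    by rewrite ler_wpM2l // mulr_ge0 ?sqr_ge0.
  rewrite exprVn ler_pdivlMr //.
  have alg (w e : R) : 16 * (w * a) ^+ 2 * (C * e) * w = 16 * a ^+ 2 * C * (w ^+ 3 * e) by ring.
  rewrite alg.
  rewrite /E (mulrA _ C); apply: ler_wpM2l; [by rewrite mulr_ge0 // mulr_ge0 ?sqr_ge0|exact: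
    le_trans h2 h3].
have hg : \sum_(j < m) 2^-1 ^+ j <= 2 :> R.
  suff -> : \sum_(j < m) 2^-1 ^+ j = 2 - 2 * 2^-1 ^+ m :> R.
    by rewrite lerBlDr lerDl mulr_ge0 ?exprn_ge0.
  elim: (m) => [|i IH]; first by rewrite big_ord0 expr0; ring.
  by rewrite big_ord_recr /= IH exprS; field.
apply: (@le_trans _ _ (4 * a ^+ 2 * E + 16 * a ^+ 2 * E * 2)).
  apply: lerD; first by rewrite ler_wpM2l // mulr_ge0 ?sqr_ge0.
  apply: (@le_trans _ _ (\sum_(j < m) 16 * a ^+ 2 * E * 2^-1 ^+ j)).
    by apply: ler_sum => j _; exact: hj.
  by rewrite -mulr_sumr; apply: ler_wpM2l => //; rewrite mulr_ge0 // mulr_ge0 ?sqr_ge0.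
by rewrite le_eqVlt; apply/orP; left; apply/eqP; ring.
Qed.

End TailMoment.

(** * Borel functions in a separable space *)

Section SeparableBorel.
Context {R : realType} {B : completeNormedModType R}.

Definition dense_seq (q : nat -> B) : Prop :=
  forall (x : B) (e : R), 0 < e -> exists k, `|x - q k| < e.

Lemma separable_dense_seq : separable B -> exists q, dense_seq q.
Proof.
move=> [A [/countable_injP[f finj] dA]].
(* [f] is injective on [A], so the index determines the point; indices outside its image give 0. *)
exists (fun n => xget 0 [set a | A a /\ f a = n]) => x e e0.
have [y [/= xy Ay]] : ball x e `&` A !=set0.
  apply: dA; last exact: ball_open.
  by exists x; exact: ballxx.
exists (f y); case: xgetP => [z _ [Az fz]|/(_ y)]; last by move=> /(_ (conj Ay erefl)).
have -> : z = y by apply: finj; [exact: mem_set|exact: mem_set|exact: fz].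
by rewrite -ball_normE in xy.
Qed.

Context {d : measure_display} {T : measurableType d}.

Lemma borel_measurable_open (X : T -> B) :
  (forall U, open U -> measurable (X @^-1` U)) ->
  borel_measurable_wrt (@measurable d T) X.
Proof.
move=> hX; apply: (@smallest_sub _ _ _ [set V | measurable (X @^-1` V)]); last exact: hX.
split => [|V mV|V mV] /=.
- by rewrite preimage_set0.
- by rewrite setTD preimage_setC; exact: measurableC.
- by rewrite preimage_bigcup; apply: bigcupT_measurable => i; exact: mV.
Qed.

Lemma borel_open (U : set B) : open U -> <<s @open B >> U.
Proof. exact: sub_sigma_algebra. Qed.

(** By separability the preimage of an open set is a countable union of events where X and Y lie in
    small balls around points of the dense sequence. *)
Lemma borel_measurableD (X Y : T -> B) : separable B ->
  borel_measurable_wrt (@measurable d T) X ->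
  borel_measurable_wrt (@measurable d T) Y ->
  borel_measurable_wrt (@measurable d T) (fun w => X w + Y w).
Proof.
move=> /separable_dense_seq[q hq] mX mY; apply: borel_measurable_open => U oU.
pose C j l m := forall x y : B, `|x - q j| < m.+1%:R^-1 -> `|y - q l| < m.+1%:R^-1 -> U (x + y).
rewrite (_ : _ @^-1` _ = \bigcup_j \bigcup_l \bigcup_(m in [set m | C j l m])
    (X @^-1` ball (q j) m.+1%:R^-1 `&` Y @^-1` ball (q l) m.+1%:R^-1)).
  do 3 (apply: bigcup_measurable => ? _).
  by apply: measurableI; [apply: mX|apply: mY]; apply: borel_open; exact: ball_open.
apply/seteqP; split => [w Uw|w [j _ [l _ [m /= hC [/= h1 h2]]]]]; last first.
  rewrite -ball_normE /= in h1 h2.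
  by apply: hC; rewrite distrC.
have [e /= e0 eU] : exists2 e : R, 0 < e & ball (X w + Y w) e `<=` U.
  by apply/nbhs_ballP; exact: open_nbhs_nbhs.
(* The two sums differ by at most four distances, each below 1 / (m + 1). *)
pose m := Num.truncn (4 / e).
have m0 : 0 < m.+1%:R^-1 :> R by rewrite invr_gt0.
have me : 4 * m.+1%:R^-1 < e.
  have /andP[_ h] := truncn_itv (divr_ge0 (ler0n R 4) (ltW e0)).
  by rewrite ltr_pdivrMr // mulrC -ltr_pdivrMr.
have [j hj] := hq (X w) _ m0; have [l hl] := hq (Y w) _ m0.
exists j => //; exists l => //; exists m.
  move=> x y hx hy; apply: eU; rewrite -ball_normE /=.
  rewrite (_ : X w + Y w - (x + y) = (X w - q j) + (q j - x) + ((Y w - q l) + (q l - y)));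
    last first.
    by rewrite !addrA !subrK opprD addrACA addrA.
  rewrite distrC in hx; rewrite distrC in hy.
  apply: (le_lt_trans (ler_normD _ _)); apply: le_lt_trans me.
  apply: (le_trans (lerD (ler_normD _ _) (ler_normD _ _))).
  move: hj hl hx hy.
  set a1 : R := `|X w - q j|; set a2 : R := `|Y w - q l|; set a3 : R := `|q j - x|; set a4 :
    R := `|q l - y|. set v : R := m.+1%:R^-1.
  lra.
by split; rewrite /= -ball_normE /= distrC.
Qed.

Lemma borel_measurable_sum (X : nat -> T -> B) (m n : nat) : separable B ->
  (forall i, (m <= i)%N -> borel_measurable_wrt (@measurable d T) (X i)) ->
  borel_measurable_wrt (@measurable d T) (fun w => \sum_(m <= i < n) X i w).
Proof.
move=> hB hX; have [nm|/ltnW] := leqP n m.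
  under eq_fun do rewrite big_geq //.
  by apply: borel_measurable_cst; exact: sigma_algebra_measurable.
elim: n => [|n IH]; first by rewrite leqn0 => /eqP ->; under eq_fun do rewrite big_geq //;
  apply: borel_measurable_cst; exact: sigma_algebra_measurable.
rewrite leq_eqVlt => /orP[/eqP ->|mn].
  under eq_fun do rewrite big_geq //.
  by apply: borel_measurable_cst; exact: sigma_algebra_measurable.
under eq_fun do rewrite big_nat_recr //=.
by apply: borel_measurableD => //; [exact: IH|exact: hX].
Qed.

End SeparableBorel.

(** * Finite labels of the points of the space, and truncation by label *)

Section BallLabels.
Context {R : realType} {B : completeNormedModType R} (q : nat -> B) (u e : R).
Hypothesis e_gt0 : 0 < e.

(** The coordinate [None] compares the true norm with u, so that an actual value is truncated
    according to its own norm and not that of the nearby point. *)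
Definition ball_label (N : nat) (x : B) : {ffun option 'I_N -> bool} :=
  [ffun o : option 'I_N => if o is Some k then `|x - q k| < e else u < `|x|].

Definition near_point N (b : {ffun option 'I_N -> bool}) : B :=
  if [pick k | b (Some k)] is Some k then q k else 0.

(* The bound on the norm only matters for the labels which are not attained. *)
Definition small_part N (b : {ffun option 'I_N -> bool}) : B :=
  if b None || (u + e < `|near_point b|) then 0 else near_point b.

Definition large_part N (b : {ffun option 'I_N -> bool}) : B :=
  near_point b - small_part b.

Lemma borel_ball_label N (b : {ffun option 'I_N -> bool}) :
  <<s @open B >> (ball_label N @^-1` [set b]).
Proof.
pose C (o : option 'I_N) : set B :=
  let U := [set x | if o is Some k then `|x - q k| < e else u < `|x|] in
  if b o then U else ~` U.
rewrite (_ : _ @^-1` _ = \bigcap_(o in [set: option 'I_N]) C o); last first.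
  apply/seteqP; split => [x /= xb o _|x hx /=].
    by rewrite /C -xb ffunE /=; case: o => [k|]; case: ifP => [//|/negP].
  apply/ffunP => o; have := hx o I; rewrite ffunE /C /=.
  by case: (b o); case: o => [k|] //= /negP/negbTE.
apply: (@fin_bigcap_measurable _ (g_sigma_algebraType (@open B))) => [|o _].
  exact: finite_finset.
have oU : open [set x | if o is Some k then `|x - q k| < e else u < `|x|].
  case: o => [k|].
    rewrite (_ : [set _ | _] = ball (q k) e); first exact: ball_open.
    by apply/seteqP; split => x /=; rewrite -ball_normE /= distrC.
  rewrite (_ : [set _ | _] = (fun c : B => `|c|) @^-1` [set t | u < t]) //.
  by apply: open_comp; [move=> c _; exact: norm_continuous|exact: open_gt].
rewrite /C; case: (b o); first exact: sub_sigma_algebra.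
rewrite -setTD; apply: sigma_algebraCD; exact: sub_sigma_algebra.
Qed.

(** If none of the first N balls contains x, the default 0 of [near_point] costs |x|; the indicator
    term accounts for it. *)
Lemma near_point_dist N (x : B) :
  `|near_point (ball_label N x) - x| <=
  e + `|x| * (\1_[set y | forall k, (k < N)%N -> e <= `|y - q k|] x).
Proof.
rewrite /near_point; case: pickP => [k|hk].
  rewrite ffunE distrC => /ltW h; apply: (le_trans h).
  by rewrite lerDl mulr_ge0.
rewrite sub0r normrN indicE mem_set ?mulr1 ?lerDr ?ltW // => k kN.
by have := hk (Ordinal kN); rewrite ffunE /= => /negbT; rewrite -leNgt.
Qed.

Lemma normr_near_point N (x : B) : `|near_point (ball_label N x)| <= `|x| + e.
Proof.
rewrite /near_point; case: pickP => [k|hk]; last by rewrite normr0 addr_ge0 // ltW.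
rewrite ffunE => /ltW h; rewrite -[q k](subrK x) addrC.
apply: (le_trans (ler_normD _ _)); rewrite lerD2l.
by rewrite distrC.
Qed.

Lemma normr_small_part N b : 0 <= u -> `|@small_part N b| <= u + e.
Proof.
move=> u0; rewrite /small_part; case: ifP => [_|/negbT].
  by rewrite normr0 addr_ge0 // ltW.
by rewrite negb_or -leNgt => /andP[].
Qed.

Lemma large_part_label N (x : B) : large_part (ball_label N x) =
  if u < `|x| then near_point (ball_label N x) else 0.
Proof.
rewrite /large_part /small_part [ball_label N x None]ffunE.
case: (ltP u) => /= xu; first by rewrite subr0.
by rewrite ltNge (le_trans (normr_near_point N x)) ?lerD2r // subrr.
Qed.

(** As e <= u < |x|, the nearby point has norm at most 2 |x|; hence the factor 2 in the tail
    hypothesis of [sum_sqr_tail_le]. *)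
Lemma large_part_gt N (x : B) (t : R) : e <= u -> 0 <= t ->
  t < `|large_part (ball_label N x)| -> u < `|x| /\ t < 2 * `|x|.
Proof.
move=> eu t0; rewrite large_part_label; case: (ltP u) => [ux|_].
  move=> h; split=> //; apply: (lt_le_trans h).
  apply: (le_trans (normr_near_point N x)).
  by rewrite mulr_natl mulr2n lerD2l (le_trans eu) // ltW.
by rewrite normr0 ltNge t0.
Qed.

End BallLabels.

Section ApproximationL1.
Context {d : measure_display} {T : measurableType d} {R : realType}
  (P : probability T R) {B : completeNormedModType R}
  (q : nat -> B) (u e : R).
Hypothesis e_gt0 : 0 < e.
Hypothesis hq : dense_seq q.

Lemma ball_label_fiber (G : set (set T)) (X : T -> B) N
    (b : {ffun option 'I_N -> bool}) :
  borel_measurable_wrt G X ->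
  G ((fun w => ball_label q u e N (X w)) @^-1` [set b]).
Proof. by move=> mX; apply: (mX (ball_label q u e N @^-1` [set b])); exact: borel_ball_label.
  Qed.

(** One e is the ball radius, the other bounds the integral of |X| over the event that no ball is
    hit, by dominated convergence. All large N are allowed so that finitely many variables can share
    one N. *)
Lemma near_point_cvgL1 (X : T -> B) : Lp_space P 1 X ->
  exists N0, forall N, (N0 <= N)%N ->
    (\int[P]_w (`|near_point q (ball_label q u e N (X w)) - X w|%R)%:E <=
     (2 * e)%:E)%E.
Proof.
move=> [mX LX]; pose E N := [set y : B | forall k, (k < N)%N -> e <= `|y - q k|].
have mnX : measurable_fun [set: T] (fun w => `|X w| : R).
  have := measurable_fun_norm_borel 0 mX.
  by apply: eq_measurable_fun => w _; rewrite sub0r normrN.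
have mE N : measurable (X @^-1` E N).
  rewrite (_ : _ @^-1` _ = \bigcap_(k in [set k | (k < N)%N]) (X @^-1` (~` ball (q k) e))).
    apply: fin_bigcap_measurable => [|k _]; [exact: finite_II|apply: mX].
    rewrite -setTD; apply: sigma_algebraCD; apply: sub_sigma_algebra; exact: ball_open.
  apply/seteqP; split => w /= h k /= kN; have := h k kN.
    by rewrite -ball_normE /= distrC leNgt => /negP.
  by rewrite -ball_normE /= distrC leNgt => /negP.
pose f N w : \bar R := (`|X w| * \1_(E N) (X w))%:E.
have mf N : measurable_fun [set: T] (f N).
  apply/measurable_EFinP; apply: measurable_funM => //.
  by rewrite (_ : (fun _ => _) = \1_(X @^-1` E N)) //; exact: measurable_indic.
have iX : P.-integrable [set: T] (fun w => (`|X w|%R)%:E).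
  apply/integrableP; split; first exact/measurable_EFinP.
  move: LX; rewrite unlock; apply: le_lt_trans; rewrite le_eqVlt; apply/orP; left; apply/eqP.
  by apply: eq_integral => w _ /=; rewrite normr_id powRr1.
have : (\int[P]_w f N w)%E @[N --> \oo] --> (\int[P]_w (cst 0 w))%E.
  apply: (@dominated_cvg _ _ _ P [set: T] measurableT f (cst 0%E) (fun w => (`|X w|%R)%:E))
    => //.
    move=> w _; apply: cvg_near_cst.
    have [k hk] := hq (X w) e_gt0; exists k.+1 => // N /= kN.
    rewrite /f indicE memNset ?mulr0 // => /(_ k kN); by rewrite leNgt hk.
  move=> N w _; rewrite /f gee0_abs ?lee_fin ?mulr_ge0 //.
  by rewrite ler_piMr // indicE; case: (_ \in _).
rewrite integral0 => f0.
have [N0 _ hN0] : \forall N \near \oo, (\int[P]_w f N w < e%:E)%E.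
  apply: (f0 [set x | (x < e%:E)%E]); apply: open_nbhs_nbhs.
  by split; [exact: open_ereal_lt_ereal|rewrite /= lte_fin].
exists N0 => N /hN0 /= hN.
apply: (@le_trans _ _ (\int[P]_w (e%:E + f N w))%E).
  apply: ge0_le_integral => //=.
  - apply/measurable_EFinP; apply: (measurable_fun_norm_label_sub (L := fun w => ball_label q
    u e N (X w))) => // b.
    exact: ball_label_fiber.
  - by apply: emeasurable_funD.
  - by move=> w _; rewrite /f -EFinD lee_fin near_point_dist.
rewrite ge0_integralD //=; last 2 first.
- by move=> w _; rewrite lee_fin ltW.
- by move=> w _; rewrite /f lee_fin mulr_ge0.
rewrite integral_cst //.
rewrite [X in (_ * X + _)%E](@probability_setT _ _ _ P) mule1 mulr_natl mulr2n EFinD.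
by rewrite leeD2l // ltW.
Qed.

End ApproximationL1.

(** * Discretization of the martingale differences *)

Section CenteredCoordinates.
Context {R : realType} {B : normedModType R} (n : nat) (J : finType) (j0 : J).
Local Notation K := {ffun 'I_n -> J}.
Implicit Types (k : K) (f g : J -> B).

Definition letter (i : nat) (k : K) : J :=
  if insub i is Some j then k j else j0.

(** The letters before time i; the others are masked by [j0] so that histories of all lengths live
    in one type. *)
Definition hist (i : nat) (k : K) : K :=
  [ffun j : 'I_n => if (j < i)%N then k j else j0].

Lemma hist_le i j k k' : (i <= j)%N -> hist j k = hist j k' -> hist i k = hist i k'.
Proof.
move=> ij /ffunP e; apply/ffunP => l; have := e l; rewrite !ffunE.
by case: (ltnP l i) => // li; rewrite (leq_trans li ij).
Qed.

Lemma letter_hist i k k' : hist i.+1 k = hist i.+1 k' -> letter i k = letter i k'.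
Proof.
move=> /ffunP e; rewrite /letter; case: insubP => // j _ ji.
by have := e j; rewrite !ffunE ji ltnSn.
Qed.

Variable p : K -> R.
Hypothesis p_ge0 : forall k, 0 <= p k.

Definition drift f (i : nat) (k : K) : B :=
  if i is 0 then 0 else condavg p (hist i) (fun k' => f (letter i k')) k.

Definition centered f (i : nat) (k : K) : B := f (letter i k) - drift f i k.

Lemma centered_martingale_difference f :
  finite_martingale_difference p hist (centered f).
Proof.
split=> [i k k'|i k k' e|[//|i] v _]; first exact: hist_le.
  rewrite /centered (letter_hist e); congr (_ - _); rewrite /drift.
  by case: i e => // i e; apply: condavg_eq; exact: hist_le e.
exact: sum_class_centered.
Qed.

Lemma driftD f g i k : drift (fun j => f j + g j) i k = drift f i k + drift g i k.
Proof. by case: i => [|i]; rewrite /drift ?addr0 // condavgD. Qed.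

Lemma normr_centered_le f (b : R) i k : 0 <= b -> (forall j, `|f j| <= b) ->
  `|centered f i k| <= 2 * b.
Proof.
move=> b0 fb; rewrite mulr_natl mulr2n (le_trans (ler_normB _ _)) // lerD //.
by case: i => [|i]; rewrite ?normr0 // normr_condavg_le.
Qed.

Lemma sum_sqr_centered_letter f i :
  \sum_k p k * `|centered f i k| ^+ 2 <= 4 * \sum_k p k * `|f (letter i k)| ^+ 2.
Proof.
case: i => [|i]; last exact: sum_sqr_centered_le.
rewrite /centered /=; under eq_bigr do rewrite subr0.
by rewrite ler_peMl ?ler1n // sumr_ge0 // => k _; rewrite mulr_ge0.
Qed.

End CenteredCoordinates.

(** * The law of the label words and the size of the drift *)

Section Truncation.
Context {d : measure_display} {Omega : measurableType d} {R : realType}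
  (P : probability Omega R) {B : completeNormedModType R}
  (X : nat -> Omega -> B) (F : nat -> set (set Omega)).
Hypothesis hX : martingale_difference P X F.
Variables (q : nat -> B) (u e : R) (n N : nat).

Local Notation J := {ffun option 'I_N -> bool}.
Local Notation K := {ffun 'I_n -> J}.
Local Notation lab := (ball_label q u e N).
Local Notation j0 := ([ffun=> false] : J).
Local Notation hst := (hist j0).
Local Notation crd := (letter j0).

(** Letter i is the label of [X i.+1]: words are indexed from 0, martingale differences from 1. *)
Definition atom (w : Omega) : K := [ffun i : 'I_n => lab (X i.+1 w)].

Definition atom_weight (k : K) : R := fine (P (atom @^-1` [set k])).

Lemma sub_filtration i : (1 <= i)%N -> F i `<=` measurable.
Proof. by case: hX => -[_ + _ _ _]; apply. Qed.

Lemma borel_X i : (1 <= i)%N -> borel_measurable_wrt (@measurable d Omega) (X i).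
Proof.
move=> i1; have [_ /(_ _ i1)[mX _] _] := hX.
exact: borel_measurable_wrt_sub (sub_filtration i1) mX.
Qed.

Lemma letter_atom i w : (i < n)%N -> crd i (atom w) = lab (X i.+1 w).
Proof.
by move=> ilt; rewrite /letter (insubT (fun i => (i < n)%N) ilt) ffunE.
Qed.

(** The history at time i consists of the labels of X_1, ..., X_i, so conditioning letter i on it
    matches conditioning X_(i+1) on F_i. *)
Lemma hist_atom_fiber i v : (1 <= i)%N ->
  F i ((fun w => hst i (atom w)) @^-1` [set v]).
Proof.
move=> i1; have [[sF _ leF] mX _] := hX.
rewrite -(sigma_algebra_id (sF _ i1)).
(* A masked coordinate imposes a condition on [v] alone. *)
pose C (j : 'I_n) : set Omega := if (j < i)%N then (fun w => lab (X j.+1 w)) @^-1` [set v j]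
  else if v j == j0 then setT else set0.
rewrite (_ : _ @^-1` _ = \bigcap_(j in [set: 'I_n]) C j); last first.
  apply/seteqP; split => [w /= wv j _|w hw /=].
    by rewrite /C -wv; case: ifP => ji; rewrite /= ?[hist _ _ _ _]ffunE ji ?ffunE ?eqxx.
  apply/ffunP => j; have := hw j I; rewrite /C !ffunE.
  by case: ifP => _ //=; case: eqP.
apply: (@fin_bigcap_measurable _ (g_sigma_algebraType (F i))) => [|j _].
  exact: finite_finset.
rewrite /C; case: ifP => [ji|_].
  apply: sub_sigma_algebra; apply: (leF j.+1 i) => //.
  by apply: ball_label_fiber; case: (mX j.+1 isT).
by case: ifP => _; [exact: measurableT|exact: measurable0].
Qed.

Lemma atom_fiber k : measurable (atom @^-1` [set k]).
Proof.
have -> : atom @^-1` [set k] = (fun w => hst n.+1 (atom w)) @^-1` [set k].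
  suff E w : hst n.+1 (atom w) = atom w by apply/seteqP; split => w /=; rewrite E.
  by apply/ffunP => j; rewrite ffunE ltnS (ltnW (ltn_ord j)).
exact/sub_filtration/hist_atom_fiber.
Qed.

Lemma atom_weight_ge0 k : 0 <= atom_weight k.
Proof. exact: fine_ge0. Qed.

Lemma atom_event (C : pred K) :
  P [set w | C (atom w)] = (\sum_(k | C k) atom_weight k)%:E.
Proof.
rewrite -[X in P X]setTI (probability_label P atom_fiber C measurableT).
by congr (_%:E); apply: eq_bigr => k _; rewrite setTI.
Qed.

Lemma sum_atom_weight : \sum_k atom_weight k = 1.
Proof.
apply: EFin_inj; rewrite -(atom_event xpredT) -[RHS](probability_setT P).
by congr (P _); apply/seteqP.
Qed.

(** On each history class, an event of F_i, the drift contributes the norm of a class sum, which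
    [norm_sum_label_le] bounds by the L^1 distance to X over that class. The classes partition the
    space. *)
Lemma sum_drift_le i : (i < n)%N ->
  ((\sum_k atom_weight k * `|drift j0 atom_weight (@near_point R B q N) i k|)%:E <=
   \int[P]_w (`|near_point q (lab (X i.+1 w)) - X i.+1 w|%R)%:E)%E.
Proof.
case: i => [|i] ilt.
  rewrite big1 ?integral_ge0 // => k _; last by rewrite normr0 mulr0.
have i1 : (1 <= i.+1)%N by [].
have [_ _ /(_ i.+2 isT)[Y [cY Y0]]] := hX; rewrite /= in cY.
rewrite (partition_big (hst i.+1) xpredT) //=.
rewrite [X in (X%:E <= _)%E](_ : _ = \sum_v `|\sum_(k | hst i.+1 k == v) atom_weight k *:
  near_point q (crd i.+1 k)|); last first.
  by apply: eq_bigr => v _; rewrite -(sum_class_normr_condavg atom_weight_ge0).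
have mdist : measurable_fun [set: Omega] (fun w => `|near_point q (crd i.+1 (atom w)) - X
  i.+2 w| : R).
  exact: (measurable_fun_norm_label_sub (fun k => near_point q (crd i.+1 k)) atom_fiber
    (borel_X _)).
have cover : [set: Omega] = \big[setU/set0]_(v <- enum K) ((fun w => hst i.+1 (atom w)) @^-1`
  [set v]).
  apply/seteqP; split => // w _; rewrite -bigcup_seq; exists (hst i.+1 (atom w)) => //=.
  by rewrite mem_enum.
rewrite (eq_integral (fun w => (`|near_point q (crd i.+1 (atom w)) - X i.+2 w|%R)%:E)); last
  first.
  by move=> w _; rewrite letter_atom.
rewrite {1}cover ge0_integral_bigsetU //; last 4 first.
- by move=> v; apply: (sub_filtration i1); exact: hist_atom_fiber.
- exact: enum_uniq.
- by move=> v v' _ _ [w [/= <- <-]].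
- by rewrite -cover; exact/measurable_EFinP.
rewrite big_enum /= -sumEFin; apply: lee_sum => v _.
have := norm_sum_label_le (P := P) (fun k => near_point q (crd i.+1 k)) (sub_filtration i1)
  (borel_X (isT : (1 <= i.+2)%N)) cY Y0
  (hist_atom_fiber v i1) atom_fiber.
apply: le_trans; rewrite lee_fin le_eqVlt; apply/orP; left; apply/eqP; congr (`|_|).
rewrite big_mkcond; apply: eq_bigr => k _; case: ifP => [/eqP hk|hk].
  congr (fine (P _) *: _); apply/seteqP; split => w /= => [wk|[]//].
  by rewrite wk.
rewrite (_ : _ `&` _ = set0) ?measure0 ?scale0r //.
by apply/seteqP; split => // w /= [h1 h2]; move: hk; rewrite -h2 h1 eqxx.
Qed.

End Truncation.

(** Index 0 may be included, as the empty partial sum has norm 0 <= r. *)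
Lemma lt_max_norm_sum (T : Type) (R : realType) (B : completeNormedModType R)
    (X : nat -> T -> B) (n : nat) (w : T) (r : R) : 0 <= r ->
  (r < max_norm_sum X n w) = [exists j : 'I_n.+1, r < `|partial_sum X j w|].
Proof.
move=> r0; have hmax (s : seq nat) (f : nat -> R) :
    (r < \big[Num.max/0]_(k <- s) f k) = has (fun k => r < f k) s.
  elim: s => [|k s IH]; first by rewrite big_nil ltNge r0.
  by rewrite big_cons lt_max IH.
rewrite /max_norm_sum hmax; apply/hasP/existsP => [[k]|[j hj]].
  by rewrite mem_index_iota ltnS => /andP[_ kn] hk; exists (Ordinal (kn : (k < n.+1)%N)).
exists (j : nat) => //; rewrite mem_index_iota ltn_ord andbT lt0n.
by apply: contraTneq hj => ->; rewrite /partial_sum big_geq // normr0 ltNge r0.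
Qed.

Lemma measurable_max_norm_sum (d : measure_display) (T : measurableType d)
    (R : realType) (B : completeNormedModType R) (X : nat -> T -> B)
    (n : nat) (r : R) : separable B -> 0 <= r ->
  (forall i, (1 <= i)%N -> borel_measurable_wrt (@measurable d T) (X i)) ->
  measurable [set w | r < max_norm_sum X n w].
Proof.
move=> hB r0 mX.
rewrite (_ : [set _ | _] = \bigcup_(j in [set: 'I_n.+1]) [set w | r < `|partial_sum X j w|]).
  apply: fin_bigcup_measurable => [|j _]; first exact: finite_finset.
  by apply: measurable_norm_gt; exact: borel_measurable_sum.
apply/seteqP; split => [w /=|w [j _ /= hj]]; rewrite lt_max_norm_sum //.
  by move=> /existsP[j hj]; exists j.
by apply/existsP; exists j.
Qed.

(** * Reduction of the maximum to two finite martingales and an error *)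

Section MaximalTruncation.
Context {d : measure_display} {Omega : measurableType d} {R : realType}
  (P : probability Omega R) {B : completeNormedModType R}
  (X : nat -> Omega -> B) (F : nat -> set (set Omega)).
Hypothesis hX : martingale_difference P X F.
Hypothesis hB : separable B.
Variables (q : nat -> B) (u e : R) (n N : nat).

Local Notation J := {ffun option 'I_N -> bool}.
Local Notation lab := (ball_label q u e N).
Local Notation j0 := ([ffun=> false] : J).
Local Notation crd := (letter j0).
Local Notation atm := (@atom d Omega R B X q u e n N).
Local Notation pk := (@atom_weight d Omega R P B X q u e n N).
Local Notation near := (@near_point R B q N).
Local Notation dV := (centered j0 pk (@small_part R B q u e N)).
Local Notation dW := (centered j0 pk (@large_part R B q u e N)).

(** Each partial sum is the bounded walk plus the tail walk plus an error, so exceeding r1 + r2 + r3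
    forces one of the three to exceed its share. The error is handled by Markov's inequality. *)
Lemma maximal_truncation_bound (r1 r2 r3 : R) :
  0 <= r1 -> 0 <= r2 -> 0 < r3 ->
  (forall i, (i < n)%N ->
    (\int[P]_w (`|near (lab (X i.+1 w)) - X i.+1 w|%R)%:E <= (2 * e)%:E)%E) ->
  (P [set w | (r1 + r2 + r3 < max_norm_sum X n w)%R] <=
   (\sum_(k | [exists j : 'I_n.+1, (r1 < `|walk dV j k|)%R]) pk k +
    \sum_(k | [exists j : 'I_n.+1, (r2 < `|walk dW j k|)%R]) pk k +
    n%:R * (4 * e) / r3)%:E)%E.
Proof.
move=> r10 r20 r30 hint.
have mX := borel_X hX.
(* [rho] dominates the errors of all partial sums up to n at once. *)
pose rho w : R := \sum_(i < n) (`|near (crd i (atm w)) - X i.+1 w| + `|drift j0 pk near i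
  (atm w)|).
have mnear i : measurable_fun [set: Omega] (fun w => `|near (crd i (atm w)) - X i.+1 w| : R).
  exact: (measurable_fun_norm_label_sub (fun k => near (crd i k)) (atom_fiber hX q u e (n :=
    n) (N := N)) (mX i.+1 isT)).
have mdrift i : measurable_fun [set: Omega] (fun w => `|drift j0 pk near i (atm w)| : R).
  move=> _ Y _; rewrite setTI.
  exact: (measurable_label (atom_fiber hX q u e (n := n) (N := N)) [set k | Y `|drift j0 pk
    near i k|]).
have mrho : measurable_fun [set: Omega] rho.
  by apply: measurable_sum => i; apply: measurable_funD.
have Erho : (\int[P]_w (rho w)%:E <= (n%:R * (4 * e))%:E)%E.
  rewrite (eq_integral (fun w => \sum_(i < n) ((`|near (crd i (atm w)) - X i.+1 w| + `|drift
    j0 pk near i (atm w)|)%R)%:E)%E); last first.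
    by move=> w _; rewrite sumEFin.
  rewrite ge0_integral_sum //=; last first.
    by move=> i; apply/measurable_EFinP; apply: measurable_funD.
  apply: (@le_trans _ _ (\sum_(i < n) (4 * e)%:E)%E); last first.
    by rewrite sumEFin lee_fin sumr_const card_ord -(mulr_natl (4 * e)).
  apply: lee_sum => i _; under eq_integral do rewrite EFinD.
  rewrite ge0_integralD //=; last 2 first.
  - exact/measurable_EFinP.
  - exact/measurable_EFinP.
  (* One 2 e is for the approximation, the other for the drift, which is no larger in mean. *)
  rewrite (_ : 4 * e = 2 * e + 2 * e); last by ring.
  have hi := hint _ (ltn_ord i).
  rewrite EFinD; apply: leeD.
    rewrite (eq_integral (fun w => (`|near (lab (X i.+1 w)) - X i.+1 w|%R)%:E)) //.
    by move=> w _; rewrite letter_atom.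
  rewrite (integral_label P (atom_fiber hX q u e (n := n) (N := N)) measurableT (g := fun k
    => `|drift j0 pk near i k|)) //.
  apply: le_trans hi; apply: le_trans (sum_drift_le hX q u e N (ltn_ord i)).
  rewrite lee_fin le_eqVlt; apply/orP; left; apply/eqP; apply: eq_bigr => k _.
  by rewrite setTI.
have markov3 : (P [set w | (r3 < rho w)%R] <= (n%:R * (4 * e) / r3)%:E)%E.
  have m3 : measurable [set w | r3 < rho w].
    have := mrho measurableT `]r3, +oo[%classic (measurable_itv _); rewrite setTI.
    by congr measurable; apply/seteqP; split => w /=; rewrite in_itv /= andbT.
  have rho0 w : 0 <= rho w by apply: sumr_ge0 => i _; rewrite addr_ge0.
  rewrite EFinM -[(_ * (4 * e))%R%:E]/(_)%E lee_pdivlMr //.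
  apply: le_trans Erho; rewrite muleC -integral_cst //.
  apply: (@le_trans _ _ (\int[P]_(w in [set w | (r3 < rho w)%R]) (rho w)%:E)%E).
    apply: ge0_le_integral => //=.
    - by move=> w _; rewrite lee_fin ltW.
    - exact/measurable_EFinP/measurable_funTS.
    - by move=> w /= /ltW; rewrite lee_fin.
  apply: ge0_subset_integral => //=; first exact/measurable_EFinP.
  by move=> w _; rewrite lee_fin.
rewrite EFinD; apply: le_trans (leeD (lexx _) markov3).
rewrite EFinD -!(atom_event hX).
have mE (C : pred {ffun 'I_n -> J}) : measurable [set w | C (atm w)].
  exact: (measurable_label (atom_fiber hX q u e (n := n) (N := N)) [set k | C k]).
set A1 := [set w | [exists j : 'I_n.+1, r1 < _]]; set A2 := [set w | [exists j : 'I_n.+1, r2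
  < _]]; set A3 := [set w | r3 < _].
have mA1 : measurable A1 by exact: (mE (fun k => [exists j : 'I_n.+1, r1 < `|walk dV j k|])).
have mA2 : measurable A2 by exact: (mE (fun k => [exists j : 'I_n.+1, r2 < `|walk dW j k|])).
have mA3 : measurable A3.
  have := mrho measurableT `]r3, +oo[%classic (measurable_itv _); rewrite setTI.
  by congr measurable; apply/seteqP; split => w /=; rewrite in_itv /= andbT.
have mA : measurable [set w | r1 + r2 + r3 < max_norm_sum X n w].
  by apply: measurable_max_norm_sum => //; rewrite addr_ge0 ?addr_ge0 // ltW.
apply: (@le_trans _ _ (P (A1 `|` A2 `|` A3))).
  apply: le_measure; [exact/mem_set|by apply/mem_set; apply: measurableU => //; exact:
    measurableU|].
  move=> w; rewrite /= lt_max_norm_sum; last by rewrite addr_ge0 ?addr_ge0 // ltW.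
  move=> /existsP[j hj].
  (* X is recovered from the two centered parts by adding the drift of the nearby point and
     subtracting the approximation error. *)
  have SE : partial_sum X j w = walk dV j (atm w) + walk dW j (atm w) +
      \sum_(i < j) (drift j0 pk near i (atm w) - (near (crd i (atm w)) - X i.+1 w)).
    rewrite /partial_sum big_add1 /= big_mkord /walk -!big_split /=.
    apply: eq_bigr => i _; rewrite /centered.
    have nearE : near = fun b => small_part q u e b + large_part q u e b.
      by apply/funext => b; rewrite /large_part addrC subrK.
    have gen (a b s l x : B) : x = a - s + (b - l) + (s + l - (a + b - x)).
      by rewrite (addrACA a) -opprD opprB addrA subrK addrC subrK.
    have -> : drift j0 pk near i (atm w) = drift j0 pk (@small_part R B q u e N) i (atm w) +
        drift j0 pk (@large_part R B q u e N) i (atm w).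
      by rewrite nearE; exact: driftD.
    rewrite nearE; exact: gen.
  have hrho : `|\sum_(i < j) (drift j0 pk near i (atm w) - (near (crd i (atm w)) - X i.+1
    w))| <= rho w.
    apply: (le_trans (ler_norm_sum _ _ _)).
    rewrite /rho (big_ord_widen n (fun i => `|drift j0 pk near i (atm w) - (near (crd i (atm
      w)) - X i.+1 w)|)); last by rewrite -ltnS.
    rewrite big_mkcond; apply: ler_sum => i _.
    case: ifP => _; last by rewrite addr_ge0.
    by rewrite [leRHS]addrC ler_normB.
  have [h1|h1] := leP `|walk dV j (atm w)| r1; last by left; left; apply/existsP; exists j.
  have [h2|h2] := leP `|walk dW j (atm w)| r2; last by left; right; apply/existsP; exists j.
  right; rewrite /A3 /=; apply: lt_le_trans hrho.
  rewrite ltNge; apply/negP => h3; move: hj; rewrite ltNge => /negP; apply.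
  rewrite SE (le_trans (ler_normD _ _)) // lerD //.
  by rewrite (le_trans (ler_normD _ _)) // lerD.
apply: (le_trans (measureU2 _ _ _)) => //; first exact: measurableU.
by rewrite leeD2r // measureU2.
Qed.

End MaximalTruncation.

(** * The deviation inequality *)

Section SubexponentialTail.
Context {d : measure_display} {Omega : measurableType d} {R : realType}
  (P : probability Omega R) {B : completeNormedModType R}
  (X : nat -> Omega -> B) (F : nat -> set (set Omega)) (D b C : R).
Hypothesis hX : martingale_difference P X F.
Hypothesis hB : separable B.
Hypothesis hD : rD_smooth B 2 D.
Hypothesis D_gt0 : 0 < D.
Hypothesis b_gt0 : 0 < b.
Hypothesis C_ge0 : 0 <= C.
Hypothesis hC : forall i t, (1 <= i)%N -> 0 < t ->
  (P [set w | (t < `|X i w|)%R] <= (C * expR (- t `^ b))%:E)%E.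

Lemma large_part_moment (q : nat -> B) (u e a : R) (n N i : nat) :
  0 < e -> e <= u -> u <= a -> 3 / b <= a `^ b -> (i < n)%N ->
  \sum_k atom_weight P X q u e (n := n) (N := N) k *
    `|large_part q u e (letter [ffun=> false] i k)| ^+ 2 <=
  36 * a ^+ 2 * (C * expR (- u `^ b)).
Proof.
move=> e0 eu ua ha ilt; have u0 : 0 < u := lt_le_trans e0 eu.
(* Transfers the tail of X_(i+1) at level s to the large part at level t; used with t = 0, s = u and
   with t twice s. *)
have tail t s : 0 < s -> 0 <= t ->
    (forall x, t < `|large_part q u e (ball_label q u e N x)| -> s < `|x|) ->
    \sum_(k | t < `|large_part q u e (letter [ffun=> false] i k)|)
      atom_weight P X q u e (n := n) (N := N) k <= C * expR (- s `^ b).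
  move=> s0 t0 hts; rewrite -lee_fin -(atom_event hX).
  apply: le_trans (hC (i := i.+1) isT s0); apply: le_measure.
  - apply/mem_set; exact: (measurable_label (atom_fiber hX q u e (n := n) (N := N)) [set k |
    t < `|large_part q u e (letter [ffun=> false] i k)|]).
  - by apply/mem_set/measurable_norm_gt/(borel_X hX).
  - by move=> w /=; rewrite letter_atom //; exact: hts.
apply: sum_sqr_tail_le => //.
- by move=> k; exact: atom_weight_ge0.
- by apply: (tail 0 u) => // x /(large_part_gt e0 eu (lexx 0)) [].
- move=> t ut; apply: tail; rewrite ?mulr_ge0 ?(lt_le_trans u0 ut) ?(le_trans (ltW u0) ut) //.
  have t20 : 0 <= 2 * t by rewrite mulr_ge0 ?(le_trans (ltW u0) ut).
  by move=> x /(large_part_gt e0 eu t20) []; rewrite ltr_pM2l.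
Qed.

Lemma maximal_bound_approx (u a r1 r2 r3 e : R) (n : nat) :
  (0 < n)%N -> 0 < e -> e <= u -> u <= a -> 3 / b <= a `^ b ->
  0 < r1 -> 0 < r2 -> 0 < r3 ->
  (P [set w | (r1 + r2 + r3 < max_norm_sum X n w)%R] <=
   (2 * expR (- (r1 ^+ 2 / (2 * n%:R * D * (2 * (u + e)) ^+ 2))) +
    D * (n%:R * (4 * (36 * a ^+ 2 * (C * expR (- u `^ b))))) / r2 ^+ 2 +
    n%:R * (4 * e) / r3)%:E)%E.
Proof.
move=> n0 e0 eu ua ha r10 r20 r30; have u0 : 0 < u := lt_le_trans e0 eu.
have [q hq] := separable_dense_seq hB.
have /choice[N0 hN0] : forall i : nat, exists N0 : nat, forall N, (N0 <= N)%N ->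
    (\int[P]_w (`|near_point q (ball_label q u e N (X i.+1 w)) - X i.+1 w|%R)%:E <= (2 *
      e)%:E)%E.
  move=> i.
  apply: near_point_cvgL1 => //; have [_ /(_ i.+1 isT)[mX [_ LX]] _] := hX.
  by split => //; exact: (borel_X hX (isT : (1 <= i.+1)%N)).
pose N := (\max_(i < n) N0 i)%N.
have hN i : (i < n)%N -> (N0 i <= N)%N.
  by move=> ilt; exact: (leq_bigmax (Ordinal ilt)).
apply: le_trans (maximal_truncation_bound hX hB (q := q) (u := u) (N := N) (ltW r10) (ltW
  r20) r30 _) _.
  by move=> i ilt; exact: hN0 (hN _ ilt).
rewrite lee_fin lerD2r; apply: lerD.
  (* The small part is bounded by u + e, and recentering doubles this bound. *)
  apply: (finite_martingale_tail_bounded D_gt0 (norm_le_walsh_sup hD) (walsh_sup_le_norm hD)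
    (walsh_sup_smooth hD)) => //.
  - by move=> k; exact: atom_weight_ge0.
  - exact: sum_atom_weight hX _ _ _ _ _.
  - by apply: centered_martingale_difference => k; exact: atom_weight_ge0.
  - by rewrite mulr_gt0 // addr_gt0.
  - move=> i k; apply: normr_centered_le => [k'||j]; first exact: atom_weight_ge0.
      by rewrite addr_ge0 // ltW.
    by apply: normr_small_part => //; exact: ltW.
apply: (le_trans (finite_martingale_tail_sqr D_gt0 (norm_le_walsh_sup hD) (walsh_sup_le_norm
  hD) (walsh_sup_smooth hD) _ n _ r20)).
- by move=> k; exact: atom_weight_ge0.
- by apply: centered_martingale_difference => k; exact: atom_weight_ge0.
rewrite ler_pM2r ?invr_gt0 ?exprn_gt0 // ler_pM2l //.
rewrite mulr_natl -[in leRHS](card_ord n) -sumr_const; apply: ler_sum => i _.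
apply: le_trans (sum_sqr_centered_letter _ _ _ _) _.
  by move=> k; exact: atom_weight_ge0.
by rewrite ler_pM2l // large_part_moment.
Qed.

End SubexponentialTail.

(** * The truncation level and its exponents *)

Section Constants.
Context {R : realType} (alpha D x : R) (n : nat).
Hypothesis alpha_gt0 : 0 < alpha.
Hypothesis alpha_lt1 : alpha < 1.
Hypothesis D_gt0 : 0 < D.
Hypothesis x_gt0 : 0 < x.
Hypothesis n_gt0 : (0 < n)%N.

(** The level u that balances the two exponents: u^beta is the rate for the tail part, and n x^2 /
    (16 D^2 u^2) is the same rate for the bounded part. *)
Definition trunc_level : R :=
  (x / (4 * D)) `^ (1 - alpha) * n%:R `^ ((1 - alpha) / 2).

Local Notation rate := ((x / (4 * D)) `^ (2 * alpha) * n%:R `^ alpha).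
Local Notation beta := ((2 * alpha) / (1 - alpha)).

Let n0 : 0 < n%:R :> R. Proof. by rewrite ltr0n. Qed.
Let c0 : 0 < x / (4 * D). Proof. by rewrite divr_gt0 // mulr_gt0. Qed.
Let a1 : 0 < 1 - alpha. Proof. by rewrite subr_gt0. Qed.

Lemma trunc_level_gt0 : 0 < trunc_level.
Proof. by rewrite mulr_gt0 // powR_gt0. Qed.

Lemma trunc_level_powR : trunc_level `^ beta = rate.
Proof.
rewrite /trunc_level powRM ?powR_ge0 // -!powRrM.
by congr (_ `^ _ * _ `^ _); field; rewrite gt_eqF.
Qed.

Lemma trunc_level_sqr : trunc_level ^+ 2 =
  (x / (4 * D)) `^ (2 * (1 - alpha)) * n%:R `^ (1 - alpha).
Proof.
rewrite -powR_mulrn ?(ltW trunc_level_gt0) // /trunc_level powRM ?powR_ge0 // -!powRrM.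
by congr (_ `^ _ * _ `^ _); field.
Qed.

Lemma trunc_level_rate : n%:R * x ^+ 2 = 16 * D ^+ 2 * (trunc_level ^+ 2 * rate).
Proof.
rewrite trunc_level_sqr [X in 16 * D ^+ 2 * X]mulrACA -!powRD; last 2 first.
- by apply/implyP => _; rewrite gt_eqF.
- by apply/implyP => _; rewrite gt_eqF.
rewrite (_ : 2 * (1 - alpha) + 2 * alpha = 2%:R); last by ring.
rewrite (_ : 1 - alpha + alpha = 1); last by ring.
rewrite powR_mulrn ?(ltW c0) // powRr1 ?(ltW n0) //.
by field; rewrite gt_eqF.
Qed.

(** The only loss is n^(1 - alpha) <= n; the bound produces the first term in the bracket of
    [C_const]. *)
Lemma trunc_level_sqr_le : trunc_level ^+ 2 *
    (x `^ (2 * alpha) * 16 `^ (1 - alpha) * D `^ (2 * (1 - alpha))) <= n%:R * x ^+ 2.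
Proof.
have e16 : (16 : R) `^ (1 - alpha) = 4 `^ (2 * (1 - alpha)).
  by rewrite powRrM powR_mulrn //; congr (_ `^ _); ring.
have ex : (x / (4 * D)) `^ (2 * (1 - alpha)) * (4 `^ (2 * (1 - alpha)) * D `^ (2 * (1 -
  alpha))) = x `^ (2 * (1 - alpha)).
  rewrite -powRM ?(ltW D_gt0) // -powRM ?(ltW c0) ?mulr_ge0 ?(ltW D_gt0) //.
  by congr (_ `^ _); field; rewrite gt_eqF.
have e2 : x `^ (2 * (1 - alpha)) * x `^ (2 * alpha) = x ^+ 2.
  rewrite -powRD; last by apply/implyP => _; rewrite gt_eqF.
  rewrite (_ : 2 * (1 - alpha) + 2 * alpha = 2%:R); last by ring.
  by rewrite powR_mulrn // ltW.
have n1 : n%:R `^ (1 - alpha) <= n%:R :> R.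
  rewrite -[leRHS]powRr1 ?(ltW n0) //; apply: ler_powR; first by rewrite ler1n.
  by rewrite gerBl ltW.
rewrite trunc_level_sqr e16.
set c := (x / _) `^ _ in ex *; set f := 4 `^ _ in ex *; set g := D `^ _ in ex *; set h := x
  `^ (2 * alpha) in e2 *.
rewrite (_ : _ * _ = c * (f * g) * h * n%:R `^ (1 - alpha)); last by ring.
by rewrite ex e2 mulrC ler_wpM2r // sqr_ge0.
Qed.

End Constants.

Lemma C_const_ge2 (R : realType) (D C1 alpha x : R) :
  0 <= C1 -> 2 <= C_const D C1 alpha x.
Proof.
move=> C0; rewrite /C_const lerDl; apply: mulr_ge0.
  apply: mulr_ge0 C0; apply: mulr_ge0 (sqr_ge0 D); apply: mulr_ge0 (sqr_ge0 _).
  exact: (addr_ge0 (mulr_ge0 (ler0n _ _) (exprn_ge0 _ (ler0n _ _))) (ler0n _ _)).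
apply: addr_ge0; first by rewrite invr_ge0 !mulr_ge0 ?powR_ge0.
by apply: mulr_ge0; rewrite ?invr_ge0 ?sqr_ge0 ?powR_ge0.
Qed.

Theorem theorem2p1 (R : realType) (d : measure_display)
    (Omega : measurableType d) (P : probability Omega R)
    (B : completeNormedModType R) (alpha D C1 : R)
    (X : nat -> Omega -> B) (F : nat -> set (set Omega))
    (halpha0 : 0 < alpha) (halpha1 : alpha < 1) (hD : 0 < D)
    (hBsep : separable B) (hBsmooth : rD_smooth B 2 D)
    (hX : martingale_difference P X F)
    (htail : (ereal_sup [set
        ereal_sup [set
          (expR (t `^ ((2 * alpha) / (1 - alpha))))%R%:E *
            P [set w | (t < `|X i w|)%R]
          | t in [set t : R | (0 < t)%R]]
        | i in [set i : nat | (1 <= i)%N]] <= C1%:E)%E) :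
  (forall (x : R) (n : nat), 0 < x -> (1 <= n)%N ->
     (P [set w | (n%:R * x < max_norm_sum X n w)%R] <=
      (C_const D C1 alpha x *
       expR (- ((x / (4 * D)) `^ (2 * alpha) * n%:R `^ alpha)))%R%:E)%E) /\
  (fun n : nat => fine (P [set w | n%:R < max_norm_sum X n w]) : R) =O_\oo
    (fun n : nat => expR (- (((4 * D) `^ (2 * alpha))^-1 * n%:R `^ alpha)) : R).
Proof.
pose b := (2 * alpha) / (1 - alpha).
have a1 : 0 < 1 - alpha by rewrite subr_gt0.
have b0 : 0 < b by rewrite divr_gt0 // mulr_gt0.
have hC0 i t : (1 <= i)%N -> 0 < t ->
    ((expR (t `^ b))%:E * P [set w | (t < `|X i w|)%R] <= C1%:E)%E.
  move=> i1 t0; apply: le_trans htail.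
  apply: (@le_trans _ _ (ereal_sup [set (expR (s `^ b))%:E * P [set w | (s < `|X i w|)%R] | s
    in [set s : R | (0 < s)%R]])%E).
    by apply: ereal_sup_ubound; exists t.
  by apply: ereal_sup_ubound; exists i.
have C10 : 0 <= C1.
  rewrite -lee_fin; apply: le_trans (hC0 1%N 1 isT ltr01).
  by rewrite mule_ge0 ?lee_fin ?expR_ge0.
have hC i t : (1 <= i)%N -> 0 < t ->
    (P [set w | (t < `|X i w|)%R] <= (C1 * expR (- t `^ b))%:E)%E.
  move=> i1 t0; rewrite expRN EFinM lee_pdivlMr ?expR_gt0 // muleC.
  exact: hC0.
have main (x : R) (n : nat) : 0 < x -> (1 <= n)%N ->
     (P [set w | (n%:R * x < max_norm_sum X n w)%R] <=
      (C_const D C1 alpha x *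
       expR (- ((x / (4 * D)) `^ (2 * alpha) * n%:R `^ alpha)))%R%:E)%E.
  move=> x0 n1; have n0 : 0 < n%:R :> R by rewrite ltr0n.
  have n1' : 1 <= n%:R :> R by rewrite ler1n.
  have CC0 : 0 <= C_const D C1 alpha x by rewrite (le_trans _ (C_const_ge2 _ _ _ C10)).
  (* In the zero space the event is empty. Otherwise |y|^2 <= phi y <= D |y|^2 with y nonzero gives
     D >= 1, used below for the exponent and for the constant. *)
  have [Btriv|/existsNP[y /eqP y0]] := pselect (forall y : B, y = 0).
    rewrite (_ : [set _ | _] = set0); first by rewrite measure0 lee_fin mulr_ge0 ?expR_ge0.
    apply/seteqP; split => // w /=; rewrite lt_max_norm_sum ?mulr_ge0 ?(ltW x0) //.
    move=> /existsP[j]; rewrite (Btriv (partial_sum X j w)) normr0 ltNge.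
    by rewrite mulr_ge0 // ltW.
  have D1 : 1 <= D.
    have := le_trans (norm_le_walsh_sup hBsmooth y) (walsh_sup_le_norm hBsmooth y).
    by rewrite ler_pMl // exprn_gt0 // normr_gt0.
  pose u := trunc_level alpha D x n.
  have u0 : 0 < u by exact: trunc_level_gt0.
  (* The least level from which the cubic estimate of the tail moment applies; [a] lies above it and
     above u. *)
  pose t0 := (3 / b) `^ b^-1.
  have b30 : 0 < 3 / b by rewrite divr_gt0.
  pose a := Num.max u t0.
  have ua : u <= a by rewrite le_max lexx.
  have ha : 3 / b <= a `^ b.
    apply: (@le_trans _ _ (t0 `^ b)).
      by rewrite /t0 -powRrM mulVf ?gt_eqF // powRr1 // ltW.
    have t0a : t0 <= a by rewrite le_max lexx orbT.
    have t00 : 0 <= t0 by exact: powR_ge0.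
    exact: (ge0_ler_powR (ltW b0) t00 (le_trans t00 t0a) t0a).
  have uE : u `^ b = (x / (4 * D)) `^ (2 * alpha) * n%:R `^ alpha.
    exact: trunc_level_powR.
  rewrite -uE; set A := u `^ b; have A0 : 0 <= A by exact: powR_ge0.
  have uA : n%:R * x ^+ 2 = 16 * D ^+ 2 * (u ^+ 2 * A).
    by rewrite /A uE /u; exact: trunc_level_rate.
  apply/lee_addgt0Pr => dl dl0.
  (* The first bound keeps the recentered bounded steps within 2.2 u; the second keeps the error
     term n (4 e) / (n x / 20) = 80 e / x within the slack dl. *)
  pose e := Num.min (u / 10) (x * dl / 80).
  have e0 : 0 < e by rewrite lt_min !divr_gt0 // mulr_gt0.
  have eu10 : e <= u / 10 by rewrite ge_min lexx.
  have eu : e <= u by rewrite (le_trans eu10) // ler_pdivrMr // ler_peMr ?ler1n // ltW.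
  have edl : e <= x * dl / 80 by rewrite ge_min lexx orbT.
  have nx0 : 0 < n%:R * x by rewrite mulr_gt0.
  (* The bounded part receives 9/10 of n x to preserve its exponent; the tail part and the error
     receive 1/20 each. *)
  have r10 : 0 < 9 / 10 * (n%:R * x) by rewrite mulr_gt0.
  have r20 : 0 < (n%:R * x) / 20 by rewrite divr_gt0.
  have := maximal_bound_approx hX hBsep hBsmooth hD b0 C10 hC n1 e0 eu ua ha r10 r20 r20.
  rewrite (_ : 9 / 10 * (n%:R * x) + n%:R * x / 20 + n%:R * x / 20 = n%:R * x); last by field.
  move=> /le_trans; apply; rewrite -EFinD lee_fin -/A.
  apply: lerD; last first.
    rewrite (_ : n%:R * (4 * e) / (n%:R * x / 20) = 80 * e / x); last by field; rewrite !gt_eqF.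
    by rewrite ler_pdivrMr // (mulrC 80) (mulrC dl) -ler_pdivlMr.
  rewrite /C_const [leRHS]mulrDl; apply: lerD.
    rewrite ler_pM2l // ler_expR lerN2 ler_pdivlMr; last first.
      have ue0 : 0 < 2 * (u + e) by rewrite mulr_gt0 // addr_gt0.
      apply: mulr_gt0 (exprn_gt0 2 ue0); apply: mulr_gt0 hD.
      by apply: mulr_gt0.
    (* Here 2.2^2 = 4.84 <= 5; the exponent then needs 10 <= 0.81 * 16 D = 12.96 D, which follows
       from D >= 1. *)
    have hue : (2 * (u + e)) ^+ 2 <= 5 * u ^+ 2.
      apply: (@le_trans _ _ ((2 * (u + u / 10)) ^+ 2)).
        have ue0 : 0 <= 2 * (u + e) by rewrite mulr_ge0 // addr_ge0 // ltW.
        have uu : 2 * (u + e) <= 2 * (u + u / 10) by rewrite ler_pM2l // lerD2l.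
        by rewrite lerXn2r // nnegrE // (le_trans ue0).
      by have := sqr_ge0 u; rewrite (_ : (2 * _) ^+ 2 = (121 / 25) * u ^+ 2); [lra|field].
    have -> : (9 / 10 * (n%:R * x)) ^+ 2 = 81 / 100 * n%:R * (n%:R * x ^+ 2) by field.
    rewrite uA; apply: (@le_trans _ _ (A * (2 * n%:R * D * (5 * u ^+ 2)))).
      by rewrite ler_wpM2l // ler_wpM2l // !mulr_ge0 // ltW.
    rewrite (_ : A * _ = 10 * (n%:R * D * u ^+ 2 * A)); last by ring.
    rewrite (_ : _ * (16 * _ * _) = (1296 / 100 * D) * (n%:R * D * u ^+ 2 * A)); last by field.
    have W0 : 0 <= n%:R * D * u ^+ 2 * A.
      apply: mulr_ge0 A0; apply: mulr_ge0 (sqr_ge0 u).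
      exact: mulr_ge0 (ltW n0) (ltW hD).
    by apply: ler_wpM2r W0 _ _ _; lra.
  set Z := _ * _ * D `^ _; set T := _ `^ ((1 - alpha) / alpha).
  have Z0 : 0 < Z by rewrite !mulr_gt0 ?powR_gt0.
  have T0 : 0 <= T by exact: powR_ge0.
  have uZ : u ^+ 2 <= n%:R * x ^+ 2 * Z^-1.
    by rewrite ler_pdivlMr //; exact: trunc_level_sqr_le.
  have t0T : t0 ^+ 2 = T.
    rewrite -powR_mulrn ?powR_ge0 // /t0 -powRrM /T /b.
    by congr (_ `^ _); field; rewrite !gt_eqF.
  (* Replacing the maximum by a sum yields one summand for each term in the bracket of [C_const]. *)
  have a2 : a ^+ 2 <= u ^+ 2 + t0 ^+ 2.
    by rewrite /a; case: (leP u t0) => _; rewrite ?lerDl ?lerDr sqr_ge0.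
  have nx2 : 0 < n%:R * x ^+ 2 by rewrite mulr_gt0 ?exprn_gt0.
  have hq : a ^+ 2 / (n%:R * x ^+ 2) <= Z^-1 + (x ^+ 2)^-1 * T.
    rewrite ler_pdivrMr // (le_trans a2) // mulrDl t0T; apply: lerD.
      by rewrite mulrC.
    rewrite (_ : _ * _ * _ = n%:R * T); last by field; rewrite gt_eqF.
    by rewrite ler_peMl.
  (* The numerical factor is 4 * 36 * 20^2 = 57600, below 1007156. *)
  rewrite (_ : D * (n%:R * (4 * (36 * a ^+ 2 * (C1 * expR (- A))))) / (n%:R * x / 20) ^+ 2 =
    576 * 10 ^+ 2 * D * C1 * (a ^+ 2 / (n%:R * x ^+ 2)) * expR (- A)); last by field; rewrite
      !gt_eqF.
  have hK : 576 * 10 ^+ 2 <= 1007 * 10 ^+ 3 + 156 :> R by lra.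
  have Q0 : 0 <= a ^+ 2 / (n%:R * x ^+ 2).
    exact: divr_ge0 (sqr_ge0 a) (ltW nx2).
  have K0 : 0 <= 576 * 10 ^+ 2 :> R.
    exact: mulr_ge0 (ler0n _ _) (exprn_ge0 _ (ler0n _ _)).
  move: (576 * 10 ^+ 2) (1007 * 10 ^+ 3 + 156) hK K0 => k K kK k0.
  have K0 := le_trans k0 kK.
  have E1 : 1 <= expR 1 ^+ 2 :> R by rewrite exprn_ege1 // -expR0 ler_expR.
  have D2 : D <= expR 1 ^+ 2 * D ^+ 2.
    apply: (@le_trans _ _ (D ^+ 2)); first by rewrite expr2 ler_peMr // ltW.
    by rewrite ler_peMl ?sqr_ge0.
  apply: ler_wpM2r (expR_ge0 _) _ _ _.
  apply: (@le_trans _ _ (K * expR 1 ^+ 2 * D ^+ 2 * C1 * (a ^+ 2 / (n%:R * x ^+ 2)))).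
    apply: ler_wpM2r Q0 _ _ _; apply: ler_wpM2r C10 _ _ _.
    apply: (@le_trans _ _ (K * D)); first exact: ler_wpM2r (ltW hD) _ _ kK.
    by rewrite -mulrA ler_wpM2l.
  apply: ler_wpM2l hq; apply: mulr_ge0 C10; apply: mulr_ge0 (sqr_ge0 D).
  exact: mulr_ge0 K0 (le_trans ler01 E1).
split=> //.
have C0 : 0 < C_const D C1 alpha 1 by rewrite (lt_le_trans _ (C_const_ge2 _ _ _ C10)).
apply/eqO_exP; exists (C_const D C1 alpha 1) => //; exists 1%N => // n /= n1.
have := main 1 n ltr01 n1; rewrite mulr1 => h.
rewrite ger0_norm ?fine_ge0 // (ger0_norm (expR_ge0 _)).
have -> : ((4 * D) `^ (2 * alpha))^-1 = (1 / (4 * D)) `^ (2 * alpha).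
  by rewrite div1r -(powR_inv1 (mulr_ge0 (ler0n _ 4) (ltW hD))) -powRrM mulN1r powRN.
rewrite -lee_fin fineK //; apply: fin_num_measure.
apply: measurable_max_norm_sum => // i i1; exact: borel_X hX _ i1.
Qed.
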